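(* Let $G$ satisfy conditions (1)–(5) below and let $C_G\subset\mathbb{P}^n$, $n=d-g$, be the union of lines defined by an admissible labeling of $\tilde G$ (see context). Then the ideal sheaf $\mathcal{I}_{C_G}$ of $C_G$ is $3$-regular, i.e. $H^i(\mathbb{P}^n,\mathcal{I}_{C_G}(3-i))=0$ for all $i>0$.
   Context: Work over an algebraically closed field $k$ of characteristic zero, $S=k[x_0,\ldots,x_{d-g}]$. Conditions on the finite graph $G=(V,E)$, $d=|V|$, $g=|E|-d+1$: (1) connected; (2) simple; (3) every vertex has degree at most $3$ and some vertex has degree less than $3$; (4) the shortest path between any two distinct vertices of degree $3$ has at least $3$ edges; (5) no triangles. Let $\tilde G$ be obtained from $G$ by attaching one loop at each vertex of degree $1$. An admissible labeling of the edges of $\tilde G$: for each vertex of degree $3$ choose two indices $j\neq k$ in $\{0,\ldots,d-g\}$ and label its three edges $e_j,e_k,e_j-e_k$; label each remaining edge $e_i$ with an unused index, distinct indices being used throughout. An index $i$ appears on an edge labeled $e_i$ or $\pm(e_i-e_j)$. For each vertex $v$: if $v$ has degree $3$ with edges $e_j,e_k,e_j-e_k$, $I_v=(x_i: i\neq j,k)$; otherwise $I_v$ is generated by the $x_i$ with $i$ not appearing on an edge of $\tilde G$ at $v$, together with $x_j-x_k$ if some edge at $v$ is labeled $e_j-e_k$. $L_v=V(I_v)$, $C_G=\bigcup_v L_v$. *)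

(* Defs.v *)
From HB Require Import structures.
From mathcomp Require Import all_boot all_order all_algebra.
From mathcomp Require Import mpoly.
Set Implicit Arguments. Unset Strict Implicit. Unset Printing Implicit Defensive.
Import Order.TTheory GRing.Theory.
Local Open Scope ring_scope.

(* Graphs: a simple graph on a finite vertex type T is a symmetric,    *)
(* irreflexive relation e (hypotheses stated in the theorem).           *)

Section Graph.
Variables (T : finType) (e : rel T).

Definition deg (v : T) : nat := #|[set w | e v w]|.

Definition gedges : {set {set T}} := [set [set p.1; p.2] | p : T * T & e p.1 p.2].

(* edge set of G~ : edges of G plus one loop [set v] at each degree-1 vertex *)
Definition tedges : {set {set T}} :=
  gedges :|: [set [set v] | v : T & deg v == 1%N].

Definition gd : nat := #|T|.
Definition gg : nat := (#|gedges| + 1 - gd)%N.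
Definition gn : nat := (gd - gg)%N.

Definition connectedG : Prop := forall x y : T, connect e x y.

Definition deg3_far : Prop :=
  forall (u w : T) (p : seq T), u != w -> deg u = 3%N -> deg w = 3%N ->
    path e u p -> last u p = w -> (3 <= size p)%N.

Definition triangle_free : Prop :=
  forall x y z : T, ~ [/\ e x y, e y z & e z x].

(* Labels of edges of G~ with indices in 'I_N (N = n+1, indices 0..n):  *)
(* LBasis i stands for e_i and LDiff j k for e_j - e_k.                 *)
Inductive label (N : nat) := LBasis of 'I_N | LDiff of 'I_N & 'I_N.

Definition label_idx N (l : label N) : seq 'I_N :=
  match l with LBasis i => [:: i] | LDiff j k => [:: j; k] end.

Definition admissible N (lab : {set T} -> label N) : Prop :=
  (forall v, deg v = 3%N -> exists j k : 'I_N, j != k /\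
     exists f1 f2 f3 : {set T},
       [/\ [/\ f1 \in tedges, f2 \in tedges & f3 \in tedges],
           [/\ v \in f1, v \in f2 & v \in f3],
           [/\ f1 != f2, f1 != f3 & f2 != f3] &
           [/\ lab f1 = LBasis j, lab f2 = LBasis k & lab f3 = LDiff j k]]) /\
  (forall f, f \in tedges -> (forall v, v \in f -> deg v <> 3%N) ->
     exists i, lab f = LBasis i) /\
  (* distinct indices throughout: two distinct edges share an index only
     if they are edges at a common degree-3 vertex (labels e_j, e_k, e_j-e_k) *)
  (forall f f' i, f \in tedges -> f' \in tedges -> f != f' ->
     i \in label_idx (lab f) -> i \in label_idx (lab f') ->
     exists v, [/\ deg v = 3%N, v \in f & v \in f']).

Definition appears N (lab : {set T} -> label N) (v : T) (i : 'I_N) : Prop :=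
  exists f, [/\ f \in tedges, v \in f & i \in label_idx (lab f)].

Definition Iv_gen (R : nzRingType) N (lab : {set T} -> label N) (v : T)
    (p : {mpoly R[N]}) : Prop :=
  (exists i, ~ appears lab v i /\ p = 'X_i) \/
  (deg v <> 3%N /\ exists f j k, [/\ f \in tedges, v \in f,
                                   lab f = LDiff j k & p = 'X_j - 'X_k]).

(* L_v = V(I_v), as a subset of the affine cone k^(n+1) *)
Definition Lv (R : nzRingType) N (lab : {set T} -> label N) (v : T)
    (x : 'I_N -> R) : Prop :=
  forall p : {mpoly R[N]}, Iv_gen lab v p -> p.@[x] = 0.

(* the homogeneous ideal of C_G = union of the L_v (ideal of its cone) *)
Definition ideal_CG (R : nzRingType) N (lab : {set T} -> label N)
    (f : {mpoly R[N]}) : Prop :=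
  forall (v : T) (x : 'I_N -> R), Lv lab v x -> f.@[x] = 0.

End Graph.

(* Cech cohomology of the twisted sheaf  I~(m)  on P^(N-1) = Proj S,   *)
(* S = R[x_0..x_(N-1)], for a homogeneous ideal I, computed with the    *)
(* standard affine cover D_+(x_i).  Over D_+(x_s), s a nonempty set of   *)
(* indices, sections are the degree-m elements f / x_s^e of I_(x_s),     *)
(* with x_s = prod_(i in s) x_i; we represent them by pairs (f, e).      *)

Section Cech.
Variables (R : comNzRingType) (N : nat) (I : {mpoly R[N]} -> Prop) (m : int).

Definition xs (s : {set 'I_N}) : {mpoly R[N]} := \prod_(i in s) 'X_i.

Definition section (s : {set 'I_N}) (c : {mpoly R[N]} * nat) : Prop :=
  I c.1 /\ exists d : nat, c.1 \is d.-homog /\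
                           (d%:Z = m + (c.2 * #|s|)%N%:Z)%R.

Definition frac_eq (s : {set 'I_N}) (c c' : {mpoly R[N]} * nat) : Prop :=
  c.1 * xs s ^+ c'.2 = c'.1 * xs s ^+ c.2.

Definition cochain := {set 'I_N} -> {mpoly R[N]} * nat.

Definition is_cochain (p : nat) (c : cochain) : Prop :=
  forall s : {set 'I_N}, #|s| = p.+1 -> section s (c s).

Definition pos (t : {set 'I_N}) (i : 'I_N) : nat := #|[set j in t | (j < i)%N]|.

(* Cech differential on t (|t| = p+2):
   (dc)_t = sum_(i in t) (-1)^(pos i) c_(t \ i) restricted to D_+(x_t);
   c_(t\i) = f / x_(t\i)^e restricts to f x_i^e / x_t^e, and all terms are
   brought to the common denominator x_t^E, E = sum of the exponents. *)
Definition cech_d (c : cochain) (t : {set 'I_N}) : {mpoly R[N]} * nat :=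
  let E := (\sum_(i in t) (c (t :\ i)).2)%N in
  (\sum_(i in t) (-1) ^+ pos t i * (c (t :\ i)).1 * 'X_i ^+ (c (t :\ i)).2
                   * xs t ^+ (E - (c (t :\ i)).2)%N, E).

Definition cocycle (p : nat) (c : cochain) : Prop :=
  forall t : {set 'I_N}, #|t| = p.+2 -> (cech_d c t).1 = 0.

(* H^i(P^(N-1), I~(m)) = 0, for i >= 1 *)
Definition cech_vanish (i : nat) : Prop :=
  forall c, is_cochain i c -> cocycle i c ->
    exists b, is_cochain i.-1 b /\
      forall s : {set 'I_N}, #|s| = i.+1 -> frac_eq s (cech_d b s) (c s).

End Cech.

Definition sheaf_regular (R : comNzRingType) N (I : {mpoly R[N]} -> Prop)
    (r : int) : Prop :=
  forall i : nat, (0 < i)%N -> cech_vanish I (r - i%:Z) i.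

(* Main.v *)
Require Import Defs.
From HB Require Import structures.
From mathcomp Require Import all_boot all_order all_algebra.
From mathcomp Require Import mpoly zify ring.
Set Implicit Arguments. Unset Strict Implicit. Unset Printing Implicit Defensive.
Import Order.TTheory GRing.Theory.
Local Open Scope ring_scope.

(* Add the lines one at a time, in an order in which each new line [L_v] meets
   at most two of the previous ones: in any nonempty set [U] of vertices some
   [v] has at most two neighbours in [U], because [G] is connected and not
   cubic.  If [L_v = P^1] with coordinates [a, b], restriction to [L_v] maps
   the ideal [I] of the previous lines onto [l k[a,b]] in degrees >= 2, where
   [l] is the product of the at most two linear forms vanishing at the points
   already covered: this only requires a few explicit quadrics in [I], namely
   products of coordinates and of differences [x_j - x_l].  Hence the sheaf
   quotient is [O_L(-K)] with [K = deg l <= 2], and 3-regularity passes from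
   [I] to the ideal of the larger union by the long exact sequence.  The
   cohomology of [O(m)] on projective space and on the line is computed one
   Laurent monomial at a time by contracting the Cech complex with an index
   whose exponent is nonnegative. *)

(** * Cech cochains and monomial contraction *)

(** The constants come from [0 -> I' -> I -> O_L(-K) -> 0]. For [H^2(I'(1))] one needs
    [H^1(O_L(1-K)) = 0], that is [K <= 2], so no line may receive a third imposed point. For
    [H^1(I'(2))] one needs the quadrics of [I] to map onto [H^0(O_L(2-K))], which is surjectivity in
    degree 2 exactly. From the third cohomology on, the line contributes nothing. The long exact
    sequence is carried out as a chase on numerators. All cochains share a power of the product of
    the variables as denominator, and that power is raised whenever a section on the line has to be
    lifted to a polynomial in [I]. The ideal of the lines is handled as a common kernel of
    restriction maps to [k[a,b]]; only at the end is it compared with vanishing at points, where the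
    field must be infinite. *)

Section Coboundary.
Variables (V : nzRingType) (N : nat).
Implicit Types (c : {set 'I_N} -> V) (s t : {set 'I_N}) (i j : 'I_N).

Definition cobd c t : V := \sum_(i in t) (-1) ^+ pos t i * c (t :\ i).

Lemma eq_cobd c c' t : (forall i, i \in t -> c (t :\ i) = c' (t :\ i)) ->
  cobd c t = cobd c' t.
Proof. by move=> eqc; apply: eq_bigr => i it; rewrite eqc. Qed.

Lemma pos_setD1 t i j : i \in t -> pos t j = ((i < j) + pos (t :\ i) j)%N.
Proof.
move=> it; rewrite /pos (cardsD1 i) !inE it /=; congr (_ + _)%N.
by apply: eq_card => l; rewrite !inE andbA.
Qed.

(** Removing [i] then [j] or [j] then [i] leaves the same set, with opposite signs: the double sum
    is antisymmetric. *)
Lemma cobd_cobd c t : cobd (cobd c) t = 0.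
Proof.
pose G i j : V := if [&& i \in t, j \in t & i != j] then
  (-1) ^+ (pos t i + pos (t :\ i) j) * c (t :\ i :\ j) else 0.
have antiG i j : G j i = - G i j.
  rewrite /G eq_sym; case: (boolP (i \in t)) => it; rewrite ?andbF ?oppr0 //=.
  case: (boolP (j \in t)) => jt; rewrite ?oppr0 //=.
  case: eqVneq => [|neq]; rewrite ?oppr0 //=.
  have -> : t :\ j :\ i = t :\ i :\ j by rewrite setDDl setUC -setDDl.
  rewrite (pos_setD1 i jt) (pos_setD1 j it) -mulNr.
  have {}neq : val i != val j by [].
  congr (_ * _); rewrite -signr_odd -[in RHS]signr_odd -signrN.
  congr (_ ^+ (nat_of_bool _)); rewrite !oddD.
  by case: (ltngtP i j) neq => //= _ _; case: (odd _); case: (odd _).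
have -> : cobd (cobd c) t = \sum_i \sum_j G i j.
  rewrite /cobd big_mkcond; apply: eq_bigr => i _.
  case: ifP => it; last by rewrite big1 // => j _; rewrite /G it.
  rewrite mulr_sumr [LHS]big_mkcond; apply: eq_bigr => j _.
  rewrite /G it !inE /= eq_sym andbC; case: ifP => // _.
  by rewrite mulrA -exprD.
have splitG i j : G i j = (if (i < j)%N then G i j else 0) + (if (j < i)%N then G i j else 0).
  case: (ltngtP i j) => [||/val_inj ij]; rewrite ?addr0 ?add0r //.
  by rewrite /G ij eqxx !andbF.
under eq_bigr do under eq_bigr do rewrite splitG.
under eq_bigr do rewrite big_split /=.
rewrite big_split /= [X in _ + X]exchange_big /= -big_split /=.
apply: big1 => i _; rewrite -big_split /=; apply: big1 => j _.
by case: ifP; rewrite ?addr0 // antiG addNr.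
Qed.

(** The cochain under [cobd] is the standard cone homotopy with apex [i]. If [i] is in [s], only the
    term removing [i] survives and no cocycle condition is used; otherwise the condition on [i |: s]
    expresses [c s] through the other faces. *)
Lemma cobd_contract i c s : (i \notin s -> cobd c (i |: s) = 0) ->
  cobd (fun s' => if i \in s' then 0
                  else (-1) ^+ pos (i |: s') i * c (i |: s')) s = c s.
Proof.
case: (boolP (i \in s)) => [is_ _|nis /(_ isT) c0].
  rewrite /cobd (bigD1 i) //= !inE eqxx /= setD1K // mulrA -exprD addnn.
  rewrite -mul2n exprM sqrrN !expr1n mul1r big1 ?addr0 // => j /andP[js ji].
  by rewrite !inE eq_sym ji is_ mulr0.
move: c0; rewrite /cobd big_setU1 //= setU1K // => /eqP.
rewrite addr_eq0 => /eqP c0.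
apply: (can_inj (signrMK (pos (i |: s) i))); rewrite c0 -sumrN mulr_sumr.
apply: eq_bigr => j js; have ij : i != j by apply: contraNneq nis => ->.
rewrite !inE (negPf ij) (negPf nis) andbF /=.
have -> : i |: s :\ j = (i |: s) :\ j.
  by apply/setP => l; rewrite !inE; case: (eqVneq l i) => [->|//]; rewrite ij.
rewrite !mulrA -!exprD -mulNr; congr (_ * _).
have jt : j \in i |: s by rewrite !inE js orbT.
have it : i \in i |: s by rewrite !inE eqxx.
rewrite (pos_setD1 i jt) (pos_setD1 j it) setU1K //.
rewrite -signr_odd -[in RHS]signr_odd -signrN.
congr (_ ^+ (nat_of_bool _)); rewrite !oddD.
have {}neq : val i != val j by [].
by case: (ltngtP i j) neq => //= _ _; case: (odd _); case: (odd _).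
Qed.
End Coboundary.

Section HomogOfFun.
Variables (k : nzRingType) (M D : nat).

(** Lets a cochain be prescribed coefficient by coefficient, so that the apex of the contraction may
    depend on the monomial. *)
Definition homog_of_fun (g : 'X_{1..M} -> k) : {mpoly k[M]} :=
  \sum_(m : 'X_{1..M < D.+1} | mdeg m == D) g m *: 'X_[m].

Lemma mcoeff_homog_of_fun g m :
  (homog_of_fun g)@_m = if mdeg m == D then g m else 0.
Proof.
rewrite /homog_of_fun raddf_sum /=.
under eq_bigr do rewrite mcoeffZ mcoeffX.
case: ifP => degm.
  have ltm : (mdeg m < D.+1)%N by rewrite (eqP degm).
  rewrite (bigD1 (BMultinom ltm)) //= eqxx mulr1 big1 ?addr0 // => m' /andP[_ ne].
  have /negPf-> : bmnm m' != m; last by rewrite mulr0.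
  by apply: contraNneq ne => eqm; apply/eqP/val_inj.
rewrite big1 // => m' degm'; case: eqP => [eqm|]; last by rewrite mulr0.
by rewrite eqm degm in degm'.
Qed.

Lemma homog_of_fun_homog g : homog_of_fun g \is D.-homog.
Proof.
by apply: rpred_sum => m degm; apply: dhomogZ; rewrite dhomogX.
Qed.
End HomogOfFun.

Lemma mcoeff_cobd (k : nzRingType) (M N : nat) (c : {set 'I_N} -> {mpoly k[M]}) t m :
  (cobd c t)@_m = cobd (fun s => (c s)@_m) t.
Proof.
rewrite /cobd raddf_sum; apply: eq_bigr => i _ /=.
by rewrite -signr_odd -[in RHS]signr_odd !mulr_sign; case: ifP => _; rewrite ?mcoeffN.
Qed.

(* The coefficients of a fixed monomial [m] form a scalar cochain, which is
   contracted with the index [h m]. *)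
Lemma toric_exact (k : nzRingType) (M N D n : nat) (Y : {set 'I_N})
    (allowed : {set 'I_N} -> 'X_{1..M} -> bool) (h : 'X_{1..M} -> 'I_N)
    (q : {set 'I_N} -> {mpoly k[M]}) :
  (forall m, mdeg m = D -> h m \in Y) ->
  (forall m (s : {set 'I_N}), mdeg m = D -> s \subset Y -> #|s| = n -> h m \notin s ->
     allowed (h m |: s) m -> allowed s m) ->
  (forall s : {set 'I_N}, s \subset Y -> #|s| = n.+1 ->
     q s \is D.-homog /\ forall m, (q s)@_m != 0 -> allowed s m) ->
  (forall t : {set 'I_N}, t \subset Y -> #|t| = n.+2 -> cobd q t = 0) ->
  exists b : {set 'I_N} -> {mpoly k[M]},
    (forall s : {set 'I_N}, s \subset Y -> #|s| = n ->
       b s \is D.-homog /\ forall m, (b s)@_m != 0 -> allowed s m) /\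
    (forall s : {set 'I_N}, s \subset Y -> #|s| = n.+1 -> cobd b s = q s).
Proof.
move=> hY hall qP q0.
pose b (s : {set 'I_N}) := homog_of_fun D (fun m => if h m \in s then 0
  else (-1) ^+ pos (h m |: s) (h m) * (q (h m |: s))@_m).
exists b; split=> [s sY cs|s sY cs].
  split=> [|m]; first exact: homog_of_fun_homog.
  rewrite mcoeff_homog_of_fun; case: (mdeg m =P D) => [degm|]; last by rewrite eqxx.
  case: ifPn => [|hs nz]; first by rewrite eqxx.
  apply: hall => //; apply: (qP _ _ _).2; first by rewrite subUset sub1set hY.
    by rewrite cardsU1 hs cs.
  by apply: contraNneq nz => ->; rewrite mulr0.
apply/mpolyP => m; rewrite mcoeff_cobd.
case: (eqVneq (mdeg m) D) => degm.
  rewrite -(@cobd_contract _ _ (h m) (fun s => (q s)@_m) s).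
    by apply: eq_cobd => i _; rewrite mcoeff_homog_of_fun degm eqxx.
  move=> hs; rewrite -mcoeff_cobd q0 ?mcoeff0 //.
    by rewrite subUset sub1set hY.
  by rewrite cardsU1 hs cs.
have [qh _] := qP s sY cs.
rewrite (dhomog_nemf_coeff qh degm) /cobd big1 // => i _.
by rewrite mcoeff_homog_of_fun (negPf degm) mulr0.
Qed.

(** * Cochains over a common denominator *)

Record is_ideal (A : comNzRingType) (I : A -> Prop) : Prop := IsIdeal {
  ideal0 : I 0;
  idealD : forall f g, I f -> I g -> I (f + g);
  idealM : forall f g, I f -> I (f * g) }.

Section Ideal.
Variables (A : comNzRingType) (I : A -> Prop).
Hypothesis idI : is_ideal I.

Lemma idealB f g : I f -> I g -> I (f - g).
Proof.
by move=> If Ig; apply: idealD => //; rewrite -mulrN1; apply: idealM.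
Qed.

Lemma ideal_sum (J : Type) (r : seq J) (P : pred J) (F : J -> A) :
  (forall j, P j -> I (F j)) -> I (\sum_(j <- r | P j) F j).
Proof. by apply: big_ind => [|f g]; [apply: ideal0|apply: idealD]. Qed.
End Ideal.

Lemma mpolyX_neq0 (A : nzRingType) n (m : 'X_{1..n}) : 'X_[A, m] != 0.
Proof. by rewrite -msupp_eq0 msuppX. Qed.

Lemma cardsC_ord N (s : {set 'I_N}) : (#|s| + #|~: s|)%N = N.
Proof. by rewrite cardsC card_ord. Qed.

Section XS.
Variables (k : fieldType) (N : nat).
Implicit Types (s t : {set 'I_N}).
Local Notation S := {mpoly k[N]}.

Lemma xs_neq0 s : xs k s != 0.
Proof. by apply/prodf_neq0 => i _; apply: mpolyX_neq0. Qed.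

Lemma xsX_neq0 s n : xs k s ^+ n != 0.
Proof. by rewrite expf_neq0 // xs_neq0. Qed.

Lemma xs_setD1 t i : i \in t -> xs k t = 'X_i * xs k (t :\ i).
Proof. exact: big_setD1. Qed.

Lemma xs_setCD1 t i : i \in t -> xs k (~: (t :\ i)) = 'X_i * xs k (~: t).
Proof.
move=> it; rewrite (xs_setD1 (i := i)) ?inE ?eqxx //; congr (_ * xs k _).
by apply/setP => j; rewrite !inE; case: (eqVneq j i) => [->|]; rewrite ?it.
Qed.

Lemma xs_setC s : xs k s * xs k (~: s) = xs k setT.
Proof.
rewrite /xs [RHS](bigID (mem s)) /=; congr (_ * _); apply: eq_bigl => i;
by rewrite !inE.
Qed.

Lemma xs_homog s : xs k s \is #|s|.-homog.
Proof.
rewrite -sum1_card /xs; elim/big_rec2: _ => [|i n p _ IH]; first exact: dhomog1.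
by apply: dhomogM => //; rewrite dhomogX /= mdeg1.
Qed.

Lemma xsX_homog s n : xs k s ^+ n \is (#|s| * n).-homog.
Proof. exact/dhomogMn/xs_homog. Qed.
End XS.

(* [g / x_setT^E] is a section of [I~(D - E N)] over [D_+(x_s)]. *)
Definition csection (k : fieldType) N (I : {mpoly k[N]} -> Prop) (E D : nat)
    (s : {set 'I_N}) (g : {mpoly k[N]}) : Prop :=
  exists f d, [/\ I f, f \is d.-homog, (d + E * #|~: s|)%N = D
                & g = f * xs k (~: s) ^+ E].

(* Vanishing of [H^p(I~(m))] for cochains written over the common denominators
   [x_setT^E], which turns restrictions into inclusions. *)
Definition koszul_vanish (k : fieldType) N (I : {mpoly k[N]} -> Prop) (m : int) p :=
  forall E D (g : {set 'I_N} -> {mpoly k[N]}), D%:Z = m + (E * N)%N%:Z ->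
  (forall s : {set 'I_N}, #|s| = p.+1 -> csection I E D s (g s)) ->
  (forall t : {set 'I_N}, #|t| = p.+2 -> cobd g t = 0) ->
  exists r (b : {set 'I_N} -> {mpoly k[N]}),
    (forall s : {set 'I_N}, #|s| = p -> csection I (E + r) (D + r * N) s (b s)) /\
    (forall s : {set 'I_N}, #|s| = p.+1 -> cobd b s = g s * xs k setT ^+ r).

Section CechOfKoszul.
Variables (k : fieldType) (N : nat) (I : {mpoly k[N]} -> Prop) (m : int) (p : nat).
Hypotheses (idI : is_ideal I) (N_gt0 : (0 < N)%N) (p_gt0 : (0 < p)%N).

(** There are finitely many index sets, so one exponent serves as common denominator for the whole
    cochain; the primitive then has the same exponent on every set. *)
Lemma cech_vanish_of_koszul : koszul_vanish I m p -> cech_vanish I m p.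
Proof.
move=> vanI c cP c0.
(* [E] dominates every exponent, every sum of exponents used by [cech_d] as denominator, and [|m|]
   in the sense that [m + E N] is a natural number. *)
have [E [leE leEt mE]] : exists E, [/\ forall s, ((c s).2 <= E)%N,
    forall t : {set 'I_N}, (\sum_(i in t) (c (t :\ i)).2 <= E)%N & (`|m| <= E * N)%N].
  pose Sg := (\sum_(s : {set 'I_N}) (c s).2)%N.
  have leSg s : ((c s).2 <= Sg)%N by rewrite /Sg (bigD1 s) //= leq_addr.
  exists (N * Sg + `|m|)%N; split=> [s|t|].
  - by have := leSg s; have := leq_pmull Sg N_gt0; lia.
  - apply: (@leq_trans (N * Sg)); last by rewrite leq_addr.
    apply: (@leq_trans (#|t| * Sg)); first by rewrite -sum_nat_const leq_sum.
    by rewrite leq_mul // -[X in (_ <= X)%N](card_ord N) max_card.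
  - by rewrite mulnDl (leq_trans _ (leq_addl _ _)) // leq_pmulr.
have [D DE] : exists D : nat, D%:Z = m + (E * N)%N%:Z.
  by exists (absz (m + (E * N)%N%:Z)); rewrite gez0_abs //; lia.
(* The numerator of the fraction [c s] once its denominator is [x_setT^E]. *)
pose g (s : {set 'I_N}) := (c s).1 * xs k s ^+ (E - (c s).2) * xs k (~: s) ^+ E.
have gP (s : {set 'I_N}) : #|s| = p.+1 -> csection I E D s (g s).
  move=> cs; have [Ic [d [cd dE]]] := cP s cs.
  exists ((c s).1 * xs k s ^+ (E - (c s).2)), (d + #|s| * (E - (c s).2))%N.
  split=> //; [exact: idealM|exact/dhomogM/xsX_homog|].
  have := leE s; have := leq_mul (leqnn #|s|) (leE s).
  rewrite mulnBr => h1 h2; have : (E * N = E * #|s| + E * #|~: s|)%N by rewrite -mulnDr cardsC_ord.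
  by move: DE dE; rewrite [(#|s| * E)%N]mulnC [(#|s| * _)%N]mulnC in h1 *; lia.
have g0 (t : {set 'I_N}) : #|t| = p.+2 -> cobd g t = 0.
  move=> ct; have := c0 t ct; rewrite /cech_d /=; set Et := (\sum_(i in t) _)%N => z.
  have EtE : Et = (\sum_(i in t) (c (t :\ i)).2)%N by [].
  move/(_ t): leEt => leEt; rewrite -/Et in leEt.
  move: Et leEt EtE z => Et leEt EtE z.
  transitivity (0 * xs k t ^+ (E - Et) * xs k (~: t) ^+ E); last by rewrite !mul0r.
  rewrite -z /cobd !mulr_suml; apply: eq_bigr => i it.
  set e := (c (t :\ i)).2; have leeEt : (e <= Et)%N by rewrite EtE (bigD1 i) //= leq_addr.
  rewrite /g -/e xs_setCD1 // (xs_setD1 _ it) !exprMn.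
  have -> : 'X_i ^+ E = 'X_i ^+ e * 'X_i ^+ (Et - e) * 'X_i ^+ (E - Et) :> {mpoly k[N]}.
    by rewrite -!exprD; congr (_ ^+ _); lia.
  have -> : (E - e = (Et - e) + (E - Et))%N by lia.
  rewrite !exprD.
  rewrite -/e; move: (c (t :\ i)).1 ((-1) ^+ pos t i) (xs k (~: t) ^+ E) => a6 a7 a8.
  move: ('X_i ^+ e) ('X_i ^+ (Et - e)) ('X_i ^+ (E - Et)) => a1 a2 a3.
  move: (xs k (t :\ i) ^+ (Et - e)) (xs k (t :\ i) ^+ (E - Et)) => a4 a5.
  by ring.
have [r [b [bP db]]] := vanI E D g DE gP g0.
have /fin_all_exists[f fP] (s : {set 'I_N}) : exists f, #|s| = p -> exists d, [/\ I f, f \is d.-homog,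
    (d + (E + r) * #|~: s|)%N = (D + r * N)%N & b s = f * xs k (~: s) ^+ (E + r)].
  case: (#|s| =P p) => [cs|ncs]; last by exists 0.
  by have [f [d fd]] := bP s cs; exists f => _; exists d.
exists (fun s => (f s, (E + r)%N)); split=> [s|s cs].
  rewrite prednK // => cs; have [d [If fd dE _]] := fP s cs.
  split=> //=; exists d; split=> //.
  have : ((E + r) * N = (E + r) * #|s| + (E + r) * #|~: s|)%N by rewrite -mulnDr cardsC_ord.
  by move: dE DE; rewrite [((E + r) * N)%N]mulnDl /=; move: #|s| #|~: s| => u1 u2; lia.
rewrite /frac_eq /=; set Es := (\sum_(i in s) _)%N.
have EsE : (E + r <= Es)%N.
  by rewrite /Es sum_nat_const cs mulSn leq_addr.
(* Restoring this nonzero factor turns the numerator of [cech_d] into the plain coboundary of [b],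
   up to powers of [x_s]. *)
apply: (mulIf (xsX_neq0 k (~: s) (E + r))).
transitivity (cobd b s * xs k s ^+ (Es - (E + r)) * xs k s ^+ (c s).2).
  rewrite mulrAC; congr (_ * _); rewrite /cobd !mulr_suml; apply: eq_bigr => i iis.
  have cs1 : #|s :\ i| = p by move: cs; rewrite (cardsD1 i) iis => -[].
  have [d [_ _ _ ->]] := fP _ cs1.
  by rewrite xs_setCD1 // exprMn; move: ('X_i ^+ _) (xs k s ^+ _) (xs k (~: s) ^+ _) => a1 a2 a3; ring.
rewrite db // /g -(xs_setC k s) exprMn.
have -> : xs k s ^+ Es = xs k s ^+ (E - (c s).2) * xs k s ^+ r
    * xs k s ^+ (Es - (E + r)) * xs k s ^+ (c s).2.
  by rewrite -!exprD; congr (_ ^+ _); have := leE s; lia.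
rewrite exprD; move: (xs k s ^+ (E - _)) (xs k s ^+ r) (xs k s ^+ (Es - _)) => a1 a2 a3.
move: (xs k s ^+ _) (xs k (~: s) ^+ E) (xs k (~: s) ^+ r) (c s).1 => a4 a5 a6 a7.
by ring.
Qed.
End CechOfKoszul.

Lemma cobdMr (V : nzRingType) N (c : {set 'I_N} -> V) z t :
  cobd (fun s => c s * z) t = cobd c t * z.
Proof. by rewrite /cobd mulr_suml; apply: eq_bigr => i _; rewrite mulrA. Qed.

Lemma cobdB (V : nzRingType) N (c c' : {set 'I_N} -> V) t :
  cobd (fun s => c s - c' s) t = cobd c t - cobd c' t.
Proof.
by rewrite /cobd -sumrB; apply: eq_bigr => i _; rewrite mulrBr.
Qed.

Lemma csectionM (k : fieldType) N (I : {mpoly k[N]} -> Prop) E D r s g :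
  is_ideal I -> csection I E D s g ->
  csection I (E + r) (D + r * N) s (g * xs k setT ^+ r).
Proof.
move=> idI [f [d [If fd dE ->]]]; exists (f * xs k s ^+ r), (d + #|s| * r)%N; split.
- exact: idealM.
- exact/dhomogM/xsX_homog.
- by have := cardsC_ord s; move: #|s| #|~: s| dE => u w <- <-; ring.
- rewrite -(xs_setC k s) exprMn exprD.
  by move: (xs k s ^+ _) (xs k (~: s) ^+ E) (xs k (~: s) ^+ r) => a1 a2 a3; ring.
Qed.

(** Converts a condition on supports, which is what [toric_exact] delivers, into divisibility: the
    Laurent polynomial [g * X^(m1 - m0)] has no pole. *)
Lemma mpoly_divX (k : fieldType) M (m0 m1 : 'X_{1..M}) D (g : {mpoly k[M]}) :
  g \is D.-homog -> (forall m, g@_m != 0 -> (m0 <= m + m1)%MM) ->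
  exists2 f, f \is (D + mdeg m1 - mdeg m0).-homog & g * 'X_[m1] = f * 'X_[m0].
Proof.
move=> gD gm; exists (\sum_(m <- msupp g) g@_m *: 'X_[m + m1 - m0]).
  rewrite big_seq; apply: rpred_sum => m; rewrite mcoeff_msupp => nz.
  apply: dhomogZ; rewrite dhomogX /=; apply/eqP.
  have <- : mdeg m = D by apply: (dhomog_mf gD); rewrite mcoeff_msupp.
  by rewrite -mdegD -{2}(submK (gm m nz)) mdegD addnK.
rewrite {1}[g]mpolyE !mulr_suml big_seq [RHS]big_seq; apply: eq_bigr => m.
rewrite mcoeff_msupp => nz; rewrite -!scalerAl -!mpolyXD; congr (_ *: 'X_[_]).
by rewrite submK ?gm.
Qed.

Lemma mpolyMX_coeff (k : fieldType) M (m0 m : 'X_{1..M}) (g : {mpoly k[M]}) :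
  (g * 'X_[m0])@_m != 0 -> (m0 <= m)%MM.
Proof.
rewrite -mcoeff_msupp => /msuppM_le/allpairsP[[m1 m2] /= [_]].
by rewrite msuppX inE => /eqP-> ->; apply: lem_addl.
Qed.

Lemma xsX_mnm (k : fieldType) N (s : {set 'I_N}) E :
  xs k s ^+ E = 'X_[[multinom if i \in s then E else 0%N | i < N]].
Proof.
rewrite mpolyXE_id /xs -prodrXl big_mkcond /=; apply: eq_bigr => i _.
by rewrite mnmE; case: ifP.
Qed.

(** Such an [I] contains the irrelevant ideal, so its sheaf is the structure sheaf and the claim is
    [H^p(O(3-p)) = 0]. This covers both the empty union and a graph with an isolated vertex. *)
Lemma koszul_vanish_base (k : fieldType) N (I : {mpoly k[N]} -> Prop) p :
  (0 < p)%N -> (forall f i, I (f * 'X_i)) -> koszul_vanish I (3 - p%:Z) p.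
Proof.
move=> p_gt0 Ix E D g DE gP g0.
have degb (s : {set 'I_N}) : #|s| = p -> (E * #|~: s| <= D)%N.
  move=> cs; have : (E * N = E * p + E * #|~: s|)%N.
    by rewrite -mulnDr -[in RHS]cs cardsC_ord.
  move: DE; case: E {g0 gP} => [|E]; rewrite ?mul0n // [(_ * p)%N]mulSn; lia.
have I0 (s : {set 'I_N}) : #|s| = p -> exists i, i \in s.
  by move=> cs; apply/set0Pn; rewrite -card_gt0 cs.
case: (leqP N p) => [leNp|ltpN].
  exists 0%N, (fun s => 0); split=> s cs; last by have := cardsC_ord s; lia.
  have [i _] := I0 s cs.
  exists 0, (D - E * #|~: s|)%N; split; rewrite ?mul0r ?dhomog0 //.
    by rewrite -(mul0r 'X_i).
  by rewrite addn0 subnK ?degb ?addn0.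
(* The Laurent monomial [x^m / x_setT^E] is regular on [D_+(x_s)]. *)
pose al (s : {set 'I_N}) (m : 'X_{1..N}) := [forall i, (i \notin s) ==> (E <= m i)%N].
(* If all Laurent exponents [m i - E] were negative, the degree [3 - p] would be at most [- N],
   impossible for [p < N]. The index found is the apex of the contraction. *)
have ex (m : 'X_{1..N}) : mdeg m = D -> exists i, (E <= m i)%N.
  move=> dm; apply/existsP; apply: contraPT DE => /existsPn small.
  have : (D + N <= E * N)%N; last by lia.
  rewrite -dm mdegE -[X in (_ + X <= E * X)%N](card_ord N) -sum1_card -big_split /=.
  rewrite sum1_card mulnC -sum_nat_const; apply: leq_sum => i _.
  by have := small i; rewrite -ltnNge addn1.
have [||s _ cs|t _ ct|b [bP db]] := @toric_exact k N N D p setT al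
  (fun m => odflt (Ordinal ltpN) [pick i | (E <= m i)%N]) g.
- by move=> m _; apply: in_setT.
- move=> m s /ex[i Ei] _ _; case: pickP => [j Ej /= _|/(_ i)]; last by rewrite Ei.
  move=> /forallP al_; apply/forallP => l; apply/implyP => ls.
  case: (eqVneq l j) => [->//|lj]; apply: (implyP (al_ l)).
  by rewrite !inE negb_or lj.
- have [f [d [_ fd dE gE]]] := gP s cs; split.
    by rewrite gE -dE mulnC; apply/dhomogM/xsX_homog.
  move=> m; rewrite gE xsX_mnm => /mpolyMX_coeff/mnm_lepP le.
  apply/forallP => i; apply/implyP => is_.
  by have := le i; rewrite mnmE inE is_.
- exact: g0.
(* [I] is only known to contain multiples of variables; the extra factor supplies one, since [s] is
   nonempty. *)
exists 1%N, (fun s => b s * xs k setT); split=> s cs; last first.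
  by rewrite cobdMr db ?subsetT.
have [bD bal] := bP s (subsetT s) cs; have [i is_] := I0 s cs.
have [|f fd] := @mpoly_divX k N [multinom if i \in ~: s then E else 0%N | i < N] 0%MM D (b s) bD.
  move=> m /bal /forallP al_; rewrite addm0; apply/mnm_lepP => j; rewrite mnmE inE.
  by case: ifP => // js; apply: (implyP (al_ j)); rewrite js.
rewrite mpolyX0 mulr1 -xsX_mnm => bE; rewrite mdeg0 addn0 in fd.
exists (f * xs k s), (D - E * #|~: s| + #|s|)%N; split.
- by rewrite (xs_setD1 k is_) mulrA mulrAC; apply: Ix.
- apply: dhomogM; last exact: xs_homog.
  move: fd; congr (_ \is _.-homog); congr (_ - _)%N.
  rewrite mdegE -sum1_card big_distrr /= [RHS]big_mkcond; apply: eq_bigr => j _.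
  by rewrite mnmE muln1.
- have := cardsC_ord s; have := degb s cs; rewrite mulnDl; lia.
- by rewrite bE -(xs_setC k s) exprD; ring.
Qed.

(** * Adding a line *)

Local Notation va := ('X_(ord0 : 'I_2)).
Local Notation vb := ('X_(ord_max : 'I_2)).

Lemma ord2P (i : 'I_2) : i = ord0 \/ i = ord_max.
Proof. by case: i => -[|[|//]] lt; [left|right]; apply: val_inj. Qed.

Definition mnm2 (u w : nat) : 'X_{1..2} := [multinom nth 0%N [:: u; w] i | i < 2].

Lemma mnm2_0 u w : mnm2 u w ord0 = u. Proof. exact: mnmE. Qed.
Lemma mnm2_1 u w : mnm2 u w ord_max = w. Proof. exact: mnmE. Qed.
Lemma mdeg2 (m : 'X_{1..2}) : mdeg m = (m ord0 + m ord_max)%N.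
Proof.
rewrite mdegE big_ord_recl big_ord1; congr (_ + m _)%N; exact: val_inj.
Qed.
Lemma mdeg_mnm2 u w : mdeg (mnm2 u w) = (u + w)%N.
Proof. by rewrite mdeg2 mnm2_0 mnm2_1. Qed.
Lemma mnm2_le u w (m : 'X_{1..2}) : (u <= m ord0)%N -> (w <= m ord_max)%N -> (mnm2 u w <= m)%MM.
Proof.
by move=> hu hw; apply/mnm_lepP => i; rewrite mnmE; have [->|->] := ord2P i.
Qed.
Lemma mpolyX_mnm2 (k : nzRingType) u w : 'X_[k, mnm2 u w] = va ^+ u * vb ^+ w.
Proof.
rewrite mpolyXE_id big_ord_recl big_ord1 mnm2_0; congr (_ * _).
have -> : lift ord0 ord0 = ord_max :> 'I_2 by apply: val_inj.
by rewrite mnm2_1.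
Qed.

Section Step.
Variables (k : fieldType) (N : nat) (A B : {set 'I_N}).
Variables (I I' : {mpoly k[N]} -> Prop) (phi : {rmorphism {mpoly k[N]} -> {mpoly k[2]}}).
Variables (l : {mpoly k[2]}) (K : nat).
Hypotheses (idI : is_ideal I) (I'E : forall f, I' f <-> I f /\ phi f = 0).
Hypothesis phiX : forall i, phi 'X_i = if i \in A then va else if i \in B then vb else 0.
Hypotheses (disAB : [disjoint A & B]) (cardA : #|A| = 1%N).
Hypothesis B_neq0 : B != set0.
Hypotheses (l_neq0 : l != 0) (leK : (K <= 2)%N).
Hypothesis imgI : forall f d, (2 <= d)%N -> I f -> f \is d.-homog ->
  exists2 q, q \is (d - K).-homog & phi f = l * q.
Hypothesis liftI : forall q d, (2 <= d)%N -> q \is (d - K).-homog ->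
  exists f, [/\ I f, f \is d.-homog & phi f = l * q].

Local Notation Y := (A :|: B).

Lemma phi_xsX (s : {set 'I_N}) E : s \subset Y ->
  phi (xs k s) ^+ E = 'X_[mnm2 (E * #|s :&: A|) (E * #|s :&: B|)].
Proof.
move=> sY; rewrite mpolyX_mnm2 ![(E * _)%N]mulnC !exprM -exprMn; congr (_ ^+ _).
rewrite /xs rmorph_prod /= (bigID (mem A)) /=; congr (_ * _).
  rewrite (eq_bigr (fun _ => va)); last by move=> i /andP[_ iA]; rewrite phiX iA.
  by rewrite prodr_const; congr (_ ^+ _); apply: eq_card => i; rewrite !inE.
rewrite (eq_bigr (fun _ => vb)); last first.
  move=> i /andP[/(subsetP sY)]; rewrite phiX !inE => /orP[->//|iB] /negPf->.
  by rewrite iB.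
rewrite prodr_const; congr (_ ^+ _); apply: eq_card => i; rewrite !inE unfold_in /=.
apply: andb_id2l => /(subsetP sY); rewrite inE.
case: (boolP (i \in B)) => iB; rewrite ?orbT ?orbF => iA; last by rewrite iA.
by apply: contraTN iB => iA'; rewrite (disjointFr disAB iA').
Qed.

(** These are the charts that miss the line; a factor [xs k s] makes the condition on [phi]
    automatic there. *)
Lemma phi_xs0 (s : {set 'I_N}) : ~~ (s \subset Y) -> phi (xs k s) = 0.
Proof.
case/subsetPn => i is_; rewrite !inE negb_or => /andP[/negPf iA /negPf iB].
by rewrite (xs_setD1 k is_) rmorphM /= phiX iA iB mul0r.
Qed.

Lemma cardsY (s : {set 'I_N}) : s \subset Y -> (#|s :&: A| + #|s :&: B|)%N = #|s|.
Proof.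
move=> sY; rewrite -cardsUI -setIUr (setIidPl sY) setIACA setIid.
by rewrite (disjoint_setI0 disAB) setI0 cards0 addn0.
Qed.

(* The quotient [I / I'] is [l k[a,b]], and in its Cech complex the monomials
   [a^u b^w] with [u, w < 0] only occur in degrees [n >= 2]; there
   [#|A| = 1] makes contraction by an element of [B] possible. *)
Lemma toric_line_exact n E D (q : {set 'I_N} -> {mpoly k[2]}) :
  D%:Z = 2 - n%:Z - K%:Z + (2 * E)%N%:Z ->
  let al (s : {set 'I_N}) (m : 'X_{1..2}) :=
    ((s :&: A == set0) ==> (E <= m ord0)%N) && ((s :&: B == set0) ==> (E <= m ord_max)%N) in
  (forall s : {set 'I_N}, s \subset Y -> #|s| = n.+1 ->
     q s \is D.-homog /\ forall m, (q s)@_m != 0 -> al s m) ->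
  (forall t : {set 'I_N}, t \subset Y -> #|t| = n.+2 -> cobd q t = 0) ->
  exists b : {set 'I_N} -> {mpoly k[2]},
    (forall s : {set 'I_N}, s \subset Y -> #|s| = n ->
       b s \is D.-homog /\ forall m, (b s)@_m != 0 -> al s m) /\
    (forall s : {set 'I_N}, s \subset Y -> #|s| = n.+1 -> cobd b s = q s).
Proof.
move=> DE al qP q0.
have [ia iaA] : exists i, i \in A by apply/set0Pn; rewrite -card_gt0 cardA.
have [ib ibB] : exists i, i \in B by exact/set0Pn.
have nibA : ib \notin A by rewrite (disjointFl disAB).
have niaB : ia \notin B by rewrite (disjointFr disAB).
have capU i (s C : {set 'I_N}) : i \notin C -> (i |: s) :&: C = s :&: C.
  move=> iC; apply/setP => j; rewrite !inE; case: (eqVneq j i) => [->|] //.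
  by rewrite (negPf iC) !andbF.
pose h (m : 'X_{1..2}) := if (E <= m ord0)%N then ia else ib.
apply: (toric_exact (allowed := al) (h := h)) => //.
  by move=> m _; rewrite /h; case: ifP; rewrite !inE ?iaA ?ibB ?orbT.
move=> m s dm sY cs; rewrite /h; case: ifPn => [Ea _|nEa nibs].
  by rewrite /al Ea !implybT (capU _ s B niaB).
rewrite /al (capU _ s A nibA) => /andP[aA _]; rewrite aA /=.
case: (leqP E (m ord_max)) => Eb; rewrite ?implybT //.
(* Both exponents below [E] give [D <= 2 E - 2], hence [n >= 4 - K >= 2]. A set of size [n] missing
   [B] would then lie in [A], which has one element. *)
have n2 : (2 <= n)%N by move: nEa; rewrite mdeg2 in dm; rewrite -ltnNge; lia.
rewrite implybF; apply/negP => /eqP sB.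
have := cardsY sY; rewrite sB cards0 addn0 cs.
have := subset_leq_card (subsetIr s A); rewrite cardA; lia.
Qed.

(** The connecting argument: find a primitive [b] in [I], restrict it to the line, where it is a
    cocycle because [g] lies in [I'], write that cocycle as a coboundary, lift the primitive to [a3]
    in [I], and replace [b] by [b - d a3], which restricts to zero and has the same coboundary. *)
Lemma koszul_vanish_step n :
  koszul_vanish I (3 - n.+1%:Z) n.+1 -> koszul_vanish I' (3 - n.+1%:Z) n.+1.
Proof.
move=> vanI E D g DE gP g0.
have gP' (s : {set 'I_N}) : #|s| = n.+2 -> csection I E D s (g s).
  by move=> /gP[f [d [/I'E[If _] fd dE gE]]]; exists f, d.
have [r0 [b0 [b0P db0]]] := vanI E D g DE gP' g0.
(* One more factor [xs k setT] makes [E1] positive, so that [dp = 2 - n + E1 (n+1)] falls in the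
   range of [imgI]. *)
have [r [b [bP db r_gt0]]] : exists r (b : {set 'I_N} -> {mpoly k[N]}),
    [/\ forall s : {set 'I_N}, #|s| = n.+1 -> csection I (E + r) (D + r * N) s (b s),
        forall s : {set 'I_N}, #|s| = n.+2 -> cobd b s = g s * xs k setT ^+ r
      & (0 < r)%N].
  exists (r0 + 1)%N, (fun s => b0 s * xs k setT ^+ 1); split=> [s cs|s cs|].
  - by rewrite addnA mulnDl addnA; apply: csectionM => //; apply: b0P.
  - by rewrite cobdMr db0 // exprD mulrA.
  - by rewrite addn1.
move=> {r0 b0 b0P db0}.
have [E1 E1E] : exists E1, E1 = (E + r)%N by exists (E + r)%N.
have E1_gt0 : (0 < E1)%N by lia.
have [dp dpE] : exists dp : nat, dp%:Z = 2 - n%:Z + (E1 * n.+1)%N%:Z.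
  exists (2 + E1 * n.+1 - n)%N.
  by have : (n <= E1 * n.+1)%N; [rewrite (leq_trans (leqnSn n)) // leq_pmull|lia].
have dp_ge2 : (2 <= dp)%N.
  by have : (n.+1 <= E1 * n.+1)%N; [rewrite leq_pmull|lia].
have dpC (s : {set 'I_N}) e : #|s| = n.+1 -> (e * N = e * n.+1 + e * #|~: s|)%N.
  by move=> cs; rewrite -mulnDr -[in RHS]cs cardsC_ord.
have /fin_all_exists[f fP] (s : {set 'I_N}) : exists f, #|s| = n.+1 ->
    [/\ I f, f \is dp.-homog & b s = f * xs k (~: s) ^+ E1].
  case: (#|s| =P n.+1) => [cs|]; last by exists 0.
  have [f [d [If fd dE bE]]] := bP s cs; exists f => _; split; rewrite ?E1E //.
  suff -> : dp = d by [].
  have e : (E1 * N = E * N + r * N)%N by rewrite E1E mulnDl.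
  by move: dE DE dpE (dpC s E1 cs); rewrite -E1E; lia.
have /fin_all_exists[q qP] (s : {set 'I_N}) : exists q, #|s| = n.+1 ->
    q \is (dp - K).-homog /\ phi (f s) = l * q.
  case: (#|s| =P n.+1) => [cs|]; last by exists 0.
  have [If fd _] := fP s cs; have [q qd fq] := imgI dp_ge2 If fd.
  by exists q.
have card1 (t : {set 'I_N}) i m : #|t| = m.+1 -> i \in t -> #|t :\ i| = m.
  by move=> ct it; move: ct; rewrite (cardsD1 i) it => -[].
(* The cocycle condition on the line, with the factor [xs k (~: t)] cancelled before applying [phi],
   since [phi] may kill it. *)
have phi0 (t : {set 'I_N}) : #|t| = n.+2 ->
    \sum_(i in t) (-1) ^+ pos t i * phi (f (t :\ i)) * phi 'X_i ^+ E1 = 0.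
  move=> ct; have [f' [d [/I'E[_ f'0] _ _ gE]]] := gP t ct.
  have e : \sum_(i in t) (-1) ^+ pos t i * f (t :\ i) * 'X_i ^+ E1 = f' * xs k t ^+ r.
    apply: (mulIf (xsX_neq0 k (~: t) E1)).
    transitivity (cobd b t).
      rewrite /cobd mulr_suml; apply: eq_bigr => i it.
      have [_ _ ->] := fP _ (card1 t i _ ct it).
      by rewrite xs_setCD1 // exprMn !mulrA.
    rewrite db // gE -(xs_setC k t) exprMn E1E exprD.
    by move: (xs k t ^+ r) (xs k (~: t) ^+ E) (xs k (~: t) ^+ r) => a1 a2 a3; ring.
  have := congr1 phi e; rewrite rmorphM f'0 mul0r rmorph_sum => e0; rewrite -[RHS]e0.
  by apply: eq_bigr => i _; rewrite !rmorphM !rmorphXn /= rmorphN1.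
(* [phi (xs k s) ^+ E1] has exponents at most [E2] in [a] and [b], so [(ab)^E2] is a common
   denominator on the line; [Q] below is [q] written over it. *)
have [E2 E2E] : exists E2, E2 = (E1 * N)%N by exists (E1 * N)%N.
have leE2 (s C : {set 'I_N}) : (E1 * #|s :&: C| <= E2)%N.
  by rewrite E2E leq_mul // -[X in (_ <= X)%N](card_ord N) max_card.
(* Without sets of size [n.+1] the zero cochain works; otherwise this bound makes the degree [D2] a
   natural number. *)
have E1E2 : (E1 * n.+1 <= E2 \/ forall s : {set 'I_N}, #|s| <> n.+1)%N.
  case: (leqP n.+1 N) => [le|lt]; first by left; rewrite E2E leq_mul.
  by right=> s cs; have := cardsC_ord s; lia.
have [E1E2' | none] := E1E2; last first.
  exists 0%N, (fun=> 0); split=> s cs; first by case: (none s).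
  have [i is_] : exists i, i \in s by apply/set0Pn; rewrite -card_gt0 cs.
  by case: (none _ (card1 s i _ cs is_)).
have [D2 D2E] : exists D2 : nat, D2%:Z = 2 - n%:Z - K%:Z + (2 * E2)%N%:Z.
  by exists (dp - K + 2 * E2 - E1 * n.+1)%N; lia.
have [ab abE] : exists ab : {mpoly k[2]}, ab = 'X_[mnm2 E2 E2] by eexists.
have ab_neq0 : ab != 0 by rewrite abE mpolyX_neq0.
have [Q QdE] : exists Q : {set 'I_N} -> {mpoly k[2]}, forall s, Q s =
    q s * 'X_[mnm2 (E2 - E1 * #|s :&: A|) (E2 - E1 * #|s :&: B|)] by eexists.
have QE (s : {set 'I_N}) : s \subset Y -> Q s * phi (xs k s) ^+ E1 = q s * ab.
  move=> sY; rewrite phi_xsX // QdE abE -mulrA -mpolyXD; congr (_ * 'X_[_]).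
  by apply/mnmP => i; rewrite mnmDE !mnmE; case: i => -[|[|//]] ? /=; rewrite subnK.
have phiY (s : {set 'I_N}) e : s \subset Y -> phi (xs k s) ^+ e != 0.
  by move=> sY; rewrite phi_xsX // mpolyX_neq0.
have [||ba [baP dba]] := @toric_line_exact n E2 D2 Q D2E.
- move=> s sY cs; have [qd _] := qP s cs; rewrite QdE; split.
    have -> : D2 = (dp - K + mdeg (mnm2 (E2 - E1 * #|s :&: A|) (E2 - E1 * #|s :&: B|)))%N.
      rewrite mdeg_mnm2; have := leE2 s A; have := leE2 s B.
      have : (E1 * #|s :&: A| + E1 * #|s :&: B| = E1 * n.+1)%N.
        by rewrite -mulnDr cardsY // cs.
      lia.
    by apply: dhomogM => //; rewrite dhomogX.
  move=> m /mpolyMX_coeff/mnm_lepP le; apply/andP; split; apply/implyP => /eqP s0.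
    by have := le ord0; rewrite mnm2_0 s0 cards0 muln0 subn0.
  by have := le ord_max; rewrite mnm2_1 s0 cards0 muln0 subn0.
- move=> t tY ct; apply: (mulIf (phiY t E1 tY)); apply: (mulIf l_neq0).
  rewrite !mul0r -[RHS](mul0r ab) -(phi0 t ct) /cobd !mulr_suml.
  apply: eq_bigr => i it.
  have sY : t :\ i \subset Y by apply: subset_trans tY; apply: subD1set.
  have [_ ->] := qP _ (card1 t i _ ct it).
  rewrite (xs_setD1 k it) rmorphM exprMn -!mulrA; congr (_ * _).
  transitivity (l * phi 'X_i ^+ E1 * (q (t :\ i) * ab)); last by ring.
  by rewrite -QE //; move: (phi _ ^+ _) (phi _ ^+ _) => a1 a2; ring.
(* Any exponent dominating [E1] and [E2] will do: [phi (xs k s) ^+ E3] then clears the poles that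
   [ba s] may have along [a] and [b]. *)
have [E3 E3E] : exists E3, E3 = (E1 + E2 + n + 2)%N by eexists.
have nE3 : (n <= E3 * n)%N by rewrite leq_pmull // E3E; lia.
(* For [n = 0] the only [s] is empty and [d3 = 2] whatever [E3] is: global sections must lift, which
   forces [liftI] to start in degree 2. *)
have [d3 d3E] : exists d3 : nat, d3%:Z = 2 - n%:Z + (E3 * n)%N%:Z.
  by exists (2 + E3 * n - n)%N; lia.
have d3_ge2 : (2 <= d3)%N by lia.
have /fin_all_exists[f3 f3P] (s : {set 'I_N}) : exists f3, #|s| = n ->
    [/\ I f3, f3 \is d3.-homog
      & s \subset Y -> phi f3 * ab = l * ba s * phi (xs k s) ^+ E3].
  case: (#|s| =P n) => [cs|]; last by exists 0.
  case: (boolP (s \subset Y)) => sY; last first.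
    by exists 0; split; [exact: ideal0|exact: dhomog0|].
  have [bad bal] := baP s sY cs.
  have [|q' q'd q'E] := @mpoly_divX k 2 (mnm2 E2 E2)
      (mnm2 (E3 * #|s :&: A|) (E3 * #|s :&: B|)) D2 (ba s) bad.
    move=> m /bal/andP[/implyP alA /implyP alB].
    apply: mnm2_le; rewrite mnmDE ?mnm2_0 ?mnm2_1.
      case: (eqVneq (s :&: A) set0) => [/eqP/alA|]; first by lia.
      by rewrite -card_gt0 => /(leq_pmulr E3); lia.
    case: (eqVneq (s :&: B) set0) => [/eqP/alB|]; first by lia.
    by rewrite -card_gt0 => /(leq_pmulr E3); lia.
  have dE : (D2 + mdeg (mnm2 (E3 * #|s :&: A|) (E3 * #|s :&: B|)) - mdeg (mnm2 E2 E2)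
      = d3 - K)%N.
    by rewrite !mdeg_mnm2 -mulnDr cardsY // cs; lia.
  rewrite dE in q'd; have [f3 [If3 f3d f3E]] := liftI d3_ge2 q'd.
  by exists f3; split=> // _; rewrite f3E phi_xsX // -!mulrA abE -q'E.
(* The numerator over [x_s^E3] of [b - d a3]. *)
have [f4 f4E] : exists f4 : {set 'I_N} -> {mpoly k[N]}, forall s, f4 s =
    f s * xs k s ^+ (E3 - E1)
      - \sum_(i in s) (-1) ^+ pos s i * f3 (s :\ i) * 'X_i ^+ E3 by eexists.
have E31 : (E3 = E1 + (E3 - E1))%N by lia.
have f4I (s : {set 'I_N}) : #|s| = n.+1 -> I (f4 s).
  move=> cs; have [If _ _] := fP s cs; rewrite f4E; apply: (idealB idI).
    exact: idealM.
  apply: (ideal_sum idI) => i is_; rewrite mulrAC mulrC.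
  by have [If3 _ _] := f3P _ (card1 s i _ cs is_); apply: idealM.
have f4d (s : {set 'I_N}) : #|s| = n.+1 -> f4 s \is (d3 + E3).-homog.
  move=> cs; have [_ fd _] := fP s cs; rewrite f4E; apply: rpredB.
    have -> : (d3 + E3 = dp + #|s| * (E3 - E1))%N.
      rewrite cs mulnBr [(n.+1 * E3)%N]mulnC [(n.+1 * E1)%N]mulnC.
      have : (E1 * n.+1 <= E3 * n.+1)%N by rewrite leq_mul //; lia.
      by rewrite [(E3 * n.+1)%N]mulnS; lia.
    exact/dhomogM/xsX_homog.
  apply: rpred_sum => i is_; have [_ f3d _] := f3P _ (card1 s i _ cs is_).
  apply: dhomogM; first by rewrite -signr_odd mulr_sign; case: ifP; rewrite ?rpredN.
  by rewrite -[X in X.-homog]mul1n; apply: dhomogMn; rewrite dhomogX /= mdeg1.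
(* On charts meeting the line [phi (f4 s)] is already zero; on the others nothing is known about it
   and the factor [xs k s] does the work. This costs the final exponent [E3 + 1]. *)
have f40 (s : {set 'I_N}) : #|s| = n.+1 -> phi (f4 s * xs k s) = 0.
  move=> cs; rewrite rmorphM; case: (boolP (s \subset Y)) => sY; last first.
    by rewrite [X in _ * X]phi_xs0 // mulr0.
  suff -> : phi (f4 s) = 0 by rewrite mul0r.
  have [_ fE] := qP s cs.
  apply: (mulIf ab_neq0); rewrite mul0r f4E rmorphB rmorphM fE rmorphXn rmorph_sum /=.
  rewrite mulrBl mulr_suml; apply/eqP; rewrite subr_eq0; apply/eqP.
  transitivity (l * cobd ba s * phi (xs k s) ^+ E3).
    have -> : phi (xs k s) ^+ E3 = phi (xs k s) ^+ E1 * phi (xs k s) ^+ (E3 - E1).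
      by rewrite -exprD -E31.
    transitivity (l * phi (xs k s) ^+ (E3 - E1) * (q s * ab)).
      by move: (phi _ ^+ _) => a1; ring.
    by rewrite dba // -QE //; move: (phi _ ^+ _) (phi _ ^+ E1) => a1 a2; ring.
  rewrite /cobd mulr_sumr mulr_suml; apply: eq_bigr => i is_.
  have sY' : s :\ i \subset Y by apply: subset_trans sY; apply: subD1set.
  have [_ _ /(_ sY') f3E] := f3P _ (card1 s i _ cs is_).
  rewrite !rmorphM !rmorphXn /= rmorphN1 (xs_setD1 k is_) rmorphM exprMn.
  transitivity ((-1) ^+ pos s i * phi 'X_i ^+ E3 * (phi (f3 (s :\ i)) * ab)).
    rewrite f3E; move: (phi 'X_i ^+ E3) (phi (xs k (s :\ i)) ^+ E3) => a1 a2.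
    by move: ((-1) ^+ pos s i : {mpoly k[2]}) => a3; ring.
  by move: (phi 'X_i ^+ E3) ((-1) ^+ pos s i : {mpoly k[2]}) => a1 a3; ring.
pose a3 s := f3 s * xs k (~: s) ^+ E3.
have E4E : (E + (r + (E3 - E1) + 1) = E3 + 1)%N by lia.
exists (r + (E3 - E1) + 1)%N, (fun s => f4 s * xs k s * xs k (~: s) ^+ (E3 + 1)).
split=> s cs.
  rewrite E4E; exists (f4 s * xs k s), (d3 + E3 + #|s|)%N; split=> //.
  - by apply/I'E; split; [apply: idealM => //; apply: f4I|apply: f40].
  - by apply: dhomogM (xs_homog _ _); apply: f4d.
  - have e : ((E3 + 1) * N = E * N + (r + (E3 - E1) + 1) * N)%N by rewrite -E4E mulnDl.
    have := dpC s (E3 + 1)%N cs; rewrite cs [((E3 + 1) * n.+1)%N]mulnDl [(E3 * n.+1)%N]mulnS.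
    by move: DE d3E e; lia.
transitivity (cobd (fun s => (b s * xs k setT ^+ (E3 - E1) - cobd a3 s) * xs k setT) s).
  apply: eq_cobd => i is_; set s' := s :\ i; have cs' : #|s'| = n.+1 by apply: card1.
  have [_ _ ->] := fP s' cs'.
  have -> : cobd a3 s' =
      (\sum_(i in s') (-1) ^+ pos s' i * f3 (s' :\ i) * 'X_i ^+ E3) * xs k (~: s') ^+ E3.
    rewrite mulr_suml; apply: eq_bigr => j js; rewrite /a3 xs_setCD1 // exprMn.
    by rewrite !mulrA.
  rewrite f4E -(xs_setC k s') exprMn exprD expr1.
  have -> : xs k (~: s') ^+ E3 = xs k (~: s') ^+ E1 * xs k (~: s') ^+ (E3 - E1).
    by rewrite -exprD -E31.
  move: (\sum_(_ in _) _) (xs k s' ^+ _) (xs k (~: s') ^+ E1) => a1 a2 a4.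
  move: (xs k (~: s') ^+ _) => a5; ring.
rewrite cobdMr cobdB cobdMr cobd_cobd subr0 db // !exprD expr1 !mulrA //.
Qed.
End Step.

(** * Restriction to a line *)

Lemma comp_mpoly_homog (k : fieldType) n m (lq : n.-tuple {mpoly k[m]}) p d :
  (forall i, tnth lq i \is 1.-homog) -> p \is d.-homog -> p \mPo lq \is d.-homog.
Proof.
move=> lq1 pd; rewrite comp_mpolyE big_seq; apply: rpred_sum => mu mup.
apply: dhomogZ; rewrite -(dhomog_mf pd mup) /= mdegE.
elim/big_rec2: _ => [|i q e _ IH]; first exact: dhomog1.
by apply: dhomogM IH; rewrite -[X in X.-homog]mul1n; apply: dhomogMn.
Qed.

Lemma pihomogMl (k : fieldType) n d e (p q : {mpoly k[n]}) : p \is e.-homog ->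
  pihomog mdeg (e + d) (p * q) = p * pihomog mdeg d q.
Proof.
move=> pe; elim/mpolyind: q => [|c m q _ _ IH]; first by rewrite mulr0 !pihomog0 mulr0.
rewrite mulrDr !pihomogD IH mulrDr; congr (_ + _).
rewrite -scalerAr !linearZ /= -scalerAr pihomogX; congr (_ *: _).
have hpX : p * 'X_[m] \is (e + mdeg m).-homog by apply: dhomogM; rewrite ?dhomogX.
case: eqP => [<-|/eqP ne]; first by rewrite pihomog_dE.
by rewrite mulr0; apply: pihomog_ne0 hpX; rewrite eqn_add2l.
Qed.

(** Modulo [l] each variable equals its substitute, hence so does every polynomial. *)
Lemma dvd_subst (k : fieldType) n (lq : n.-tuple {mpoly k[n]}) (l h : {mpoly k[n]}) :
  (forall i, exists q, 'X_i - tnth lq i = l * q) -> exists q, h - (h \mPo lq) = l * q.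
Proof.
move=> lP.
have PM f g : (exists q, f - (f \mPo lq) = l * q) -> (exists q, g - (g \mPo lq) = l * q) ->
    exists q, f * g - (f * g \mPo lq) = l * q.
  move=> [q1 e1] [q2 e2]; exists (q1 * g + (f \mPo lq) * q2).
  rewrite rmorphM /= mulrDr mulrA -e1 mulrCA -e2; ring.
have P1 : exists q, 1 - (1 \mPo lq) = l * q :> {mpoly k[n]}.
  by exists 0; rewrite rmorph1 subrr mulr0.
elim/mpolyind: h => [|c m p _ _ [q2 e2]]; first by exists 0; rewrite rmorph0 subrr mulr0.
have [q1 e1] : exists q, 'X_[m] - ('X_[m] \mPo lq) = l * q.
  rewrite mpolyXE_id; elim/big_rec: _ => // i g _; apply: (PM).
  elim: (m i) => [|e IH]; first by rewrite expr0.
  rewrite exprS; apply: (PM) IH; have [q qE] := lP i; exists q.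
  by rewrite comp_mpolyXU -tnth_nth.
exists (c *: q1 + q2); rewrite mulrDr -scalerAr -e1 -e2 raddfD /= comp_mpolyZ.
by rewrite scalerBr opprD addrACA.
Qed.

(** Evaluation at a point with the scalar kept as a variable: [sub2 va 0], [sub2 0 vb] and
    [sub2 va va] restrict to the cones over (1:0), (0:1) and (1:1). *)
Definition sub2 (k : fieldType) (x y : {mpoly k[2]}) : {mpoly k[2]} -> {mpoly k[2]} :=
  comp_mpoly [tuple x; y].
HB.instance Definition _ (k : fieldType) (x y : {mpoly k[2]}) :=
  GRing.RMorphism.copy (sub2 x y) (comp_mpoly [tuple x; y]).

Section Sub2.
Variable k : fieldType.
Implicit Types (x y l h : {mpoly k[2]}).

Lemma sub2_0 x y : sub2 x y va = x.
Proof. by rewrite /sub2 comp_mpolyXU. Qed.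
Lemma sub2_1 x y : sub2 x y vb = y.
Proof. by rewrite /sub2 comp_mpolyXU. Qed.

Lemma dvd_sub2 x y l h : (exists q, va - x = l * q) -> (exists q, vb - y = l * q) ->
  sub2 x y h = 0 -> exists q, h = l * q.
Proof.
move=> lx ly h0; rewrite -[h]subr0 -h0; apply: dvd_subst => i.
by have [->|->] := ord2P i.
Qed.

(* [b1], [b2], [b3] tell whether the points (1:0), (0:1), (1:1) are imposed. *)
Definition line_eqn (b1 b2 b3 : bool) : {mpoly k[2]} :=
  vb ^+ b1 * va ^+ b2 * (va - vb) ^+ b3.

Lemma va_neq0 : va != 0 :> {mpoly k[2]}. Proof. exact: mpolyX_neq0. Qed.
Lemma vb_neq0 : vb != 0 :> {mpoly k[2]}. Proof. exact: mpolyX_neq0. Qed.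
Lemma vab_neq0 : va - vb != 0 :> {mpoly k[2]}.
Proof.
apply/eqP => /(congr1 (sub2 0 vb)) /eqP.
by rewrite rmorphB rmorph0 /= sub2_0 sub2_1 sub0r oppr_eq0 (negPf vb_neq0).
Qed.

Lemma line_eqn_neq0 b1 b2 b3 : line_eqn b1 b2 b3 != 0.
Proof.
by rewrite !mulf_neq0 ?expf_neq0 ?va_neq0 ?vb_neq0 ?vab_neq0.
Qed.

Lemma va_homog : va \is [in k[2], 1.-homog]. Proof. by rewrite dhomogX /= mdeg1. Qed.
Lemma vb_homog : vb \is [in k[2], 1.-homog]. Proof. by rewrite dhomogX /= mdeg1. Qed.

Lemma line_eqn_homog b1 b2 b3 : line_eqn b1 b2 b3 \is (b1 + b2 + b3).-homog.
Proof.
have hX p (b : bool) : p \is 1.-homog -> p ^+ b \is [in k[2], b.-homog].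
  by move=> hp; rewrite -[X in X.-homog]mul1n; apply: dhomogMn.
by do 2?[apply: dhomogM]; apply: hX; rewrite ?rpredB ?va_homog ?vb_homog.
Qed.

(** The factors are split off one by one: those already removed do not vanish at the next point, so
    its condition passes to the quotient. *)
Lemma line_eqn_dvd (b1 b2 b3 : bool) h : (b1 -> sub2 va 0 h = 0) -> (b2 -> sub2 0 vb h = 0) ->
  (b3 -> sub2 va va h = 0) -> exists q, h = line_eqn b1 b2 b3 * q.
Proof.
move=> h1 h2 h3.
have [q1 e1] : exists q, h = vb ^+ b1 * q.
  case: b1 h1 => [/(_ isT) h1|_]; last by exists h; rewrite mul1r.
  by apply: (dvd_sub2 _ _ h1); [exists 0|exists 1]; rewrite ?subrr ?subr0 ?mulr0 ?mulr1.
have [q2 e2] : exists q, q1 = va ^+ b2 * q.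
  case: b2 h2 => [/(_ isT) h2|_]; last by exists q1; rewrite mul1r.
  have /eqP := h2; rewrite e1 rmorphM rmorphXn /= sub2_1 mulf_eq0 expf_eq0.
  rewrite (negPf vb_neq0) andbF => /eqP h2'.
  by apply: (dvd_sub2 _ _ h2'); [exists 1|exists 0]; rewrite ?subrr ?subr0 ?mulr0 ?mulr1.
have [q3 e3] : exists q, q2 = (va - vb) ^+ b3 * q.
  case: b3 h3 => [/(_ isT) h3|_]; last by exists q2; rewrite mul1r.
  have /eqP := h3; rewrite e1 e2 !rmorphM !rmorphXn /= sub2_1 sub2_0 !mulf_eq0 !expf_eq0.
  rewrite (negPf va_neq0) !andbF => /eqP h3'.
  by apply: (dvd_sub2 _ _ h3'); [exists 0|exists (- 1)]; rewrite ?subrr ?mulr0 ?mulrN1 ?opprB.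
by exists q3; rewrite e1 e2 e3 !mulrA.
Qed.
End Sub2.

Definition line_img (k : fieldType) N (A B : {set 'I_N}) : N.-tuple {mpoly k[2]} :=
  [tuple if i \in A then va else if i \in B then vb else 0 | i < N].

Definition line_map (k : fieldType) N (A B : {set 'I_N}) : {mpoly k[N]} -> {mpoly k[2]} :=
  comp_mpoly (line_img k A B).
HB.instance Definition _ (k : fieldType) N (A B : {set 'I_N}) :=
  GRing.RMorphism.copy (line_map A B) (comp_mpoly (line_img k A B)).

Section LineStep.
Variables (k : fieldType) (N : nat) (A B : {set 'I_N}) (I : {mpoly k[N]} -> Prop).
Hypotheses (idI : is_ideal I).
Hypotheses (disAB : [disjoint A & B]) (cardA : #|A| = 1%N) (B_neq0 : B != set0).
Local Notation phi := (@line_map k N A B).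

Lemma line_mapX i : phi 'X_i = if i \in A then va else if i \in B then vb else 0.
Proof. by rewrite /line_map comp_mpolyXU -tnth_nth tnth_mktuple. Qed.

Lemma line_map_homog f d : f \is d.-homog -> phi f \is d.-homog.
Proof.
apply: comp_mpoly_homog => i; rewrite tnth_mktuple.
by case: ifP => _; [|case: ifP => _]; rewrite ?va_homog ?vb_homog ?dhomog0.
Qed.

Definition lifts d (h : {mpoly k[2]}) := exists f, [/\ I f, f \is d.-homog & phi f = h].

Lemma lifts_eq d h h' : h = h' -> lifts d h -> lifts d h'.
Proof. by move=> ->. Qed.

Lemma liftsD d h h' : lifts d h -> lifts d h' -> lifts d (h + h').
Proof.
move=> [f [If fd <-]] [f' [If' fd' <-]]; exists (f + f').
by split; [exact: idealD|exact: dhomogD|rewrite rmorphD].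
Qed.

Lemma liftsZ d c h : lifts d h -> lifts d (c *: h).
Proof.
move=> [f [If fd <-]]; exists (c *: f); split; [|exact: dhomogZ|].
  by rewrite -mul_mpolyC mulrC; apply: idealM.
by rewrite /line_map comp_mpolyZ.
Qed.

Lemma liftsB d h h' : lifts d h -> lifts d h' -> lifts d (h - h').
Proof. by move=> dh /(liftsZ (-1)); rewrite scaleN1r; apply: liftsD. Qed.

Lemma lifts_sum d (r : seq 'X_{1..2}) (P : pred 'X_{1..2}) F :
  (forall m, P m -> lifts d (F m)) -> lifts d (\sum_(m <- r | P m) F m).
Proof.
apply: big_ind => [|h h']; last exact: liftsD.
by exists 0; split; [exact: ideal0|exact: dhomog0|rewrite rmorph0].
Qed.

(** Coordinates with index in [A] and [B] restrict to [a] and [b]; hence surjectivity in degree 2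
    propagates upwards. *)
Lemma liftsM d h u w : lifts d h -> lifts (d + u + w) (h * va ^+ u * vb ^+ w).
Proof.
have [ia iaA] : exists i, i \in A by apply/set0Pn; rewrite -card_gt0 cardA.
have [ib ibB] := set0Pn _ B_neq0.
move=> [f [If fd <-]]; exists (f * 'X_ia ^+ u * 'X_ib ^+ w); split.
- by do 2!apply: idealM => //.
- have hX i e : 'X_i ^+ e \is [in k[N], e.-homog].
    by rewrite -[X in X.-homog]mul1n; apply: dhomogMn; rewrite dhomogX /= mdeg1.
  by do 2!apply: dhomogM => //.
- by rewrite !rmorphM !rmorphXn /= !line_mapX iaA (disjointFl disAB ibB) ibB.
Qed.

Lemma line_step (I' : {mpoly k[N]} -> Prop) (b1 b2 b3 : bool) n :
  (forall f, I' f <-> I f /\ phi f = 0) -> ~~ [&& b1, b2 & b3] ->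
  (forall f, I f -> b1 -> sub2 va 0 (phi f) = 0) ->
  (forall f, I f -> b2 -> sub2 0 vb (phi f) = 0) ->
  (forall f, I f -> b3 -> sub2 va va (phi f) = 0) ->
  (forall u w, (u + w + (b1 + b2 + b3) = 2)%N ->
     lifts 2 (line_eqn k b1 b2 b3 * va ^+ u * vb ^+ w)) ->
  koszul_vanish I (3 - n.+1%:Z) n.+1 ->
  koszul_vanish I' (3 - n.+1%:Z) n.+1.
Proof.
move=> I'E nb s1 s2 s3 quad; set K := (b1 + b2 + b3)%N in quad *.
have leK : (K <= 2)%N by rewrite /K; case: b1 b2 b3 nb {s1 s2 s3 quad K} => [] [] [].
apply: (@koszul_vanish_step k N A B I _ phi (line_eqn k b1 b2 b3) K) => //.
- exact: line_mapX.
- exact: line_eqn_neq0.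
- move=> f d d2 If fd.
  have [q qE] := line_eqn_dvd (s1 f If) (s2 f If) (s3 f If).
  (* The quotient [q] is not known to be homogeneous; its component of degree [d - K] already gives
     [phi f]. *)
  exists (pihomog mdeg (d - K) q); first exact: pihomogP.
  rewrite -(pihomogMl _ _ (line_eqn_homog k b1 b2 b3)) -qE -/K subnKC ?pihomog_dE ?line_map_homog //.
  by lia.
- move=> q d d2 qd; rewrite [q]mpolyE mulr_sumr big_seq; apply: lifts_sum => m mq.
  rewrite -scalerAr; apply: liftsZ.
  have dm : mdeg m = (d - K)%N by apply: (dhomog_mf qd).
  have -> : m = mnm2 (m ord0) (m ord_max).
    by apply/mnmP => i; have [->|->] := ord2P i; rewrite ?mnm2_0 ?mnm2_1.
  rewrite mpolyX_mnm2; move: dm; rewrite mdeg2; move: (m ord0) (m ord_max) => u w uw.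
  (* Splits off from [a^u b^w] a factor of degree [2 - K], to which [quad] applies. *)
  pose u' := minn u (2 - K); pose w' := (2 - K - u')%N.
  have q2 : lifts 2 (line_eqn k b1 b2 b3 * va ^+ u' * vb ^+ w') by apply: quad; lia.
  have := liftsM (u - u') (w - w') q2.
  have -> : (2 + (u - u') + (w - w') = d)%N by lia.
  apply: lifts_eq.
  have -> : va ^+ u = va ^+ u' * va ^+ (u - u') :> {mpoly k[2]}.
    by rewrite -exprD; congr (_ ^+ _); lia.
  have -> : vb ^+ w = vb ^+ w' * vb ^+ (w - w') :> {mpoly k[2]}.
    by rewrite -exprD; congr (_ ^+ _); lia.
  by rewrite -!mulrA [va ^+ (u - u') * (vb ^+ w' * _)]mulrCA.
Qed.

Lemma lifts_quad2 (b1 b2 : bool) : lifts 2 (va * vb) ->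
  (~~ b1 -> lifts 2 (va * va)) -> (~~ b2 -> lifts 2 (vb * vb)) ->
  forall u w, (u + w + (b1 + b2 + false) = 2)%N ->
  lifts 2 (line_eqn k b1 b2 false * va ^+ u * vb ^+ w).
Proof.
rewrite /line_eqn => ab; case: b1 => [_|/(_ isT) aa]; case: b2 => [_|/(_ isT) bb];
  move=> [|[|[|u]]] [|[|[|w]]] //= _;
  by first [apply: lifts_eq ab; ring|apply: lifts_eq aa; ring|apply: lifts_eq bb; ring].
Qed.

(** Each of the three quadrics vanishes at two of the points and is needed only when the remaining
    one is not imposed. Sums and differences of them give the squares. *)
Lemma lifts_quad3 (b1 b2 b3 : bool) : ~~ [&& b1, b2 & b3] ->
  (~~ b1 -> lifts 2 (va * (va - vb))) -> (~~ b2 -> lifts 2 (vb * (va - vb))) ->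
  (~~ b3 -> lifts 2 (va * vb)) ->
  forall u w, (u + w + (b1 + b2 + b3) = 2)%N ->
  lifts 2 (line_eqn k b1 b2 b3 * va ^+ u * vb ^+ w).
Proof.
rewrite /line_eqn => nb h1 h2 h3.
have s1 : ~~ b1 -> ~~ b3 -> lifts 2 (va * va).
  by move=> /h1 h1' /h3 h3'; apply: lifts_eq (liftsD h1' h3'); ring.
have s2 : ~~ b2 -> ~~ b3 -> lifts 2 (vb * vb).
  by move=> /h2 h2' /h3 h3'; apply: lifts_eq (liftsB h3' h2'); ring.
case: b1 b2 b3 nb h1 h2 h3 s1 s2 => [] [] [] //= _ h1 h2 h3 s1 s2;
  move=> [|[|[|u]]] [|[|[|w]]] //= _;
  by first [apply: lifts_eq (h1 isT); ring|apply: lifts_eq (h2 isT); ring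
     |apply: lifts_eq (h3 isT); ring|apply: lifts_eq (s1 isT isT); ring
     |apply: lifts_eq (s2 isT isT); ring].
Qed.
End LineStep.

(** * The lines of a labelled graph *)

Lemma comp_mpoly_comp (k : fieldType) n m o (lq : n.-tuple {mpoly k[m]})
    (lp : m.-tuple {mpoly k[o]}) p :
  (p \mPo lq) \mPo lp = p \mPo [tuple tnth lq i \mPo lp | i < n].
Proof.
rewrite [p \mPo lq]comp_mpolyE [RHS]comp_mpolyE raddf_sum; apply: eq_bigr => mu _ /=.
rewrite comp_mpolyZ rmorph_prod; congr (_ *: _); apply: eq_bigr => i _.
by rewrite tnth_mktuple rmorphXn.
Qed.

(** [p + 1] takes only the value 1, so it has no root and is constant. *)
Lemma poly_eq0_horner (k : closedFieldType) (p : {poly k}) :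
  (forall x, p.[x] = 0) -> p = 0.
Proof.
move=> p0; have /size_poly1P[c _ pE] : size (p + 1) == 1%N.
  apply: contraT => /closed_rootP[x].
  by rewrite rootE !hornerE p0 add0r oner_eq0.
have := p0 0; rewrite -[p](addrK 1) pE -[1]/(1%:P) -polyCB hornerC => ->.
by rewrite polyC0.
Qed.

Definition pair2 (k : nzRingType) (x y : k) : 'I_2 -> k := fun i => if i == ord0 then x else y.

Lemma mpoly2_eq0_meval (k : closedFieldType) (q : {mpoly k[2]}) :
  (forall x y, q.@[pair2 x y] = 0) -> q = 0.
Proof.
move=> q0; apply/mpolyP => m; rewrite mcoeff0.
have inner x : \sum_(m' <- msupp q) (q@_m' * x ^+ m' ord0) *: 'X^(m' ord_max) = 0 :> {poly k}.
  apply: poly_eq0_horner => y; rewrite -[RHS](q0 x y) mevalE horner_sum.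
  apply: eq_bigr => m' _; rewrite hornerZ hornerXn big_ord_recl big_ord1 -mulrA.
  by congr (_ * (_ * _ ^+ m' _)); apply: val_inj.
have outer : \sum_(m' <- msupp q | m' ord_max == m ord_max) q@_m' *: 'X^(m' ord0) = 0 :> {poly k}.
  apply: poly_eq0_horner => x; have := congr1 (coefp (m ord_max)) (inner x).
  rewrite raddf_sum /= coef0 => <-; rewrite horner_sum big_mkcond; apply: eq_bigr => m' _.
  by rewrite coefZ coefXn eq_sym hornerZ hornerXn; case: eqP => _; rewrite ?mulr1 ?mulr0.
have := congr1 (coefp (m ord0)) outer; rewrite raddf_sum /= coef0.
case: (boolP (m \in msupp q)) => [mq|]; last by rewrite -mcoeff_eq0 => /eqP.
rewrite big_mkcond (bigD1_seq m) ?msupp_uniq //= eqxx coefZ coefXn eqxx mulr1.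
rewrite big1 ?addr0 // => m' ne; case: (m' ord_max =P _) => // e1; rewrite coefZ coefXn.
case: eqP => e0; last by rewrite mulr0.
by case/eqP: ne; apply/mnmP => i; have [->|->] := ord2P i.
Qed.

(** * Edges of [G~] around a vertex *)

Section Graph.
Variables (T : finType) (e : rel T).
Hypotheses (Hsym : ssrbool.symmetric e) (Hirr : irreflexive e).
Hypotheses (Hdeg : forall v : T, (deg e v <= 3)%N).
Hypotheses (Hfar : deg3_far e) (Htri : triangle_free e).
Local Notation tedges := (tedges e).
Local Notation deg := (deg e).
Implicit Types (u v w : T) (f g : {set T}).

Lemma edge_neq v w : e v w -> v != w.
Proof. by move=> vw; apply/eqP => E; rewrite E Hirr in vw. Qed.

Lemma tedge_inv f v : f \in tedges -> v \in f ->
  (exists2 w, e v w & f = [set v; w]) \/ (deg v = 1%N /\ f = [set v]).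
Proof.
rewrite inE => /orP[/imsetP[[x y]]|/imsetP[x]]; rewrite inE /=.
  move=> xy -> /set2P[->|->]; left; first by exists y.
  by exists x; rewrite 1?Hsym // setUC.
by move=> /eqP dx -> /set1P->; right.
Qed.

Lemma tedge_pair v w : e v w -> [set v; w] \in tedges.
Proof.
by move=> vw; rewrite inE; apply/orP; left; apply/imsetP; exists (v, w); rewrite ?inE.
Qed.

Lemma tedge2 f v w : f \in tedges -> v \in f -> w \in f -> v != w ->
  e v w /\ f = [set v; w].
Proof.
move=> ft vf wf vw; have [[x vx fE]|[_ fE]] := tedge_inv ft vf; move: wf; rewrite fE.
  by case/set2P => wE; rewrite wE ?eqxx // in vw *.
by move/set1P => wE; rewrite wE eqxx in vw.
Qed.

Lemma tedge_eq f g v w : f \in tedges -> g \in tedges -> v \in f -> w \in f ->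
  v \in g -> w \in g -> v != w -> f = g.
Proof.
by move=> ft gt vf wf vg wg vw; have [_ ->] := tedge2 ft vf wf vw;
  have [_ ->] := tedge2 gt vg wg vw.
Qed.

Lemma deg3_adj u w : e u w -> deg u = 3%N -> deg w <> 3%N.
Proof.
move=> uw du dw; have := Hfar (p := [:: w]) (edge_neq uw) du dw.
by rewrite /= uw => /(_ isT erefl).
Qed.

Lemma deg3_common v u u' : e v u -> e v u' -> deg u = 3%N -> deg u' = 3%N -> u = u'.
Proof.
move=> vu vu' du du'; apply/eqP; apply: contraT => ne.
have := Hfar (p := [:: v; u']) ne du du'.
by rewrite /= Hsym vu vu' => /(_ isT erefl).
Qed.

Definition edges_at v : {set {set T}} := [set f in tedges | v \in f].

Lemma edges_at_deg3 v f1 f2 f3 f : deg v = 3%N -> f1 \in edges_at v ->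
  f2 \in edges_at v -> f3 \in edges_at v -> f1 != f2 -> f1 != f3 -> f2 != f3 ->
  f \in edges_at v -> [\/ f = f1, f = f2 | f = f3].
Proof.
move=> dv h1 h2 h3 n12 n13 n23.
have sub : edges_at v \subset [set [set v; w] | w in [set w | e v w]].
  apply/subsetP => g; rewrite inE => /andP[gt vg].
  have [[w vw ->]|[d1 _]] := tedge_inv gt vg; last by rewrite d1 in dv.
  by apply/imsetP; exists w; rewrite ?inE.
have le3 : (#|edges_at v| <= 3)%N.
  by rewrite -dv (leq_trans (subset_leq_card sub)) // leq_imset_card.
have sub3 : [set f1; f2; f3] \subset edges_at v by rewrite !subUset !sub1set h1 h2 h3.
have c3 : #|[set f1; f2; f3]| = 3%N.
  by rewrite setUC cardsU1 cards2 !inE negb_or eq_sym n13 eq_sym n23 n12.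
have /eqP <- : [set f1; f2; f3] == edges_at v by rewrite eqEcard sub3 c3.
by rewrite !inE -orbA => /or3P[] /eqP ->; [constructor 1|constructor 2|constructor 3].
Qed.

(** At a vertex of degree 1 the second edge is the loop added in [G~]. *)
Lemma edges_at_deg2 v : deg v <> 3%N -> deg v <> 0%N ->
  exists f1 f2, [/\ f1 \in edges_at v, f2 \in edges_at v, f1 != f2
    & forall f, f \in edges_at v -> f = f1 \/ f = f2].
Proof.
move=> n3 n0; have := Hdeg v.
case dv : (deg v) n3 n0 => [|[|[|[|//]]]] // _ _ _.
  have /cards1P[w wE] := introT eqP dv.
  have vw : e v w by have := set11 w; rewrite -wE inE.
  have nvw := edge_neq vw.
  exists [set v; w], [set v]; split.
  - by rewrite inE tedge_pair // set21.
  - rewrite inE set11 andbT inE; apply/orP; right; apply/imsetP; exists v => //.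
    by rewrite inE dv.
  - by apply/eqP => /setP/(_ w); rewrite !inE eqxx orbT eq_sym (negPf nvw).
  - move=> f; rewrite inE => /andP[ft vf].
    have [[x vx ->]|[_ ->]] := tedge_inv ft vf; [left|by right].
    by have : x \in [set w0 | e v w0] by [rewrite inE]; rewrite wE => /set1P->.
have /cards2P[w1 [w2 [n12 wE]]] := introT eqP dv.
have vw1 : e v w1 by have := set21 w1 w2; rewrite -wE inE.
have vw2 : e v w2 by have := set22 w1 w2; rewrite -wE inE.
exists [set v; w1], [set v; w2]; split.
- by rewrite inE tedge_pair // set21.
- by rewrite inE tedge_pair // set21.
- apply/eqP => /setP/(_ w1); rewrite !inE eqxx orbT (negPf n12) orbF.
  by rewrite eq_sym (negPf (edge_neq vw1)).
- move=> f; rewrite inE => /andP[ft vf].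
  have [[x vx ->]|[d1 _]] := tedge_inv ft vf; last by rewrite d1 in dv.
  have : x \in [set w0 | e v w0] by rewrite inE.
  by rewrite wE => /set2P[->|->]; [left|right].
Qed.

(** * Which edges can share an index *)

Section Labeling.
Variables (N : nat) (lab : {set T} -> label N).
Hypothesis Hlab : admissible e lab.

Local Notation idx f := (label_idx (lab f)).

Record star u (j l : 'I_N) (h1 h2 h3 : {set T}) : Prop := Star {
  star_deg : deg u = 3%N;
  star_neq : j != l;
  star1 : h1 \in edges_at u;
  star2 : h2 \in edges_at u;
  star3 : h3 \in edges_at u;
  star12 : h1 != h2;
  star13 : h1 != h3;
  star23 : h2 != h3;
  star_lab1 : lab h1 = LBasis j;
  star_lab2 : lab h2 = LBasis l;
  star_lab3 : lab h3 = LDiff j l }.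

Lemma star_exists u : deg u = 3%N -> exists j l h1 h2 h3, star u j l h1 h2 h3.
Proof.
move=> du; have [H1 _] := Hlab.
have [j [l [jl [h1 [h2 [h3 [[t1 t2 t3] [u1 u2 u3] [n12 n13 n23] [l1 l2 l3]]]]]]]] := H1 u du.
by exists j, l, h1, h2, h3; split=> //; rewrite inE ?t1 ?t2 ?t3.
Qed.

Lemma star_edge u j l h1 h2 h3 f : star u j l h1 h2 h3 -> f \in edges_at u ->
  [\/ f = h1, f = h2 | f = h3].
Proof.
by case=> du _ in1 in2 in3 n12 n13 n23 _ _ _; apply: edges_at_deg3 n12 n13 n23.
Qed.

Lemma share_index f g i : f \in tedges -> g \in tedges -> i \in idx f -> i \in idx g ->
  f = g \/ exists u, [/\ deg u = 3%N, u \in f & u \in g].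
Proof.
move=> ft gt iff ig; case: (eqVneq f g) => [|ne]; [by left|right].
by have [_ [_ h]] := Hlab; apply: h ne iff ig.
Qed.

Lemma edges_atP v f : reflect (f \in tedges /\ v \in f) (f \in edges_at v).
Proof. exact: setIdP. Qed.

(** A shared index forces a common vertex of degree 3, different from [v], and two edges with two
    common vertices coincide. *)
Lemma disjoint_index v f g i : deg v <> 3%N -> f \in edges_at v -> g \in edges_at v ->
  i \in idx f -> i \in idx g -> f = g.
Proof.
move=> dv /edges_atP[ft vf] /edges_atP[gt vg] iff ig.
have [//|[u [du uf ug]]] := share_index ft gt iff ig.
by apply: (tedge_eq ft gt vf uf vg ug); apply/eqP => E; rewrite E in dv.
Qed.

Lemma appearsP v i : appears e lab v i <-> exists2 f, f \in edges_at v & i \in idx f.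
Proof.
split=> [[f [ft vf fi]]|[f /edges_atP[ft vf] fi]]; last by exists f.
by exists f => //; apply/edges_atP.
Qed.

Lemma label_nonempty f : exists i, i \in idx f.
Proof. by case: (lab f) => [i|i j]; exists i; rewrite inE eqxx. Qed.

(** This makes [x_i x_l] vanish on every other line. An index of an edge at [v] reaches [w] along
    that edge or through a degree-3 neighbour of [v]. Two direct edges coincide, two degree-3
    neighbours coincide by [Hfar], and the mixed case yields a triangle or equal edges. *)
Lemma not_both_appear v w f1 f2 i l : deg v <> 3%N -> w != v ->
  f1 \in edges_at v -> f2 \in edges_at v -> f1 != f2 -> i \in idx f1 -> l \in idx f2 ->
  appears e lab w i -> appears e lab w l -> False.
Proof.
move=> dv wv /edges_atP[t1 v1] /edges_atP[t2 v2] n12 i1 l2.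
move=> [g [gt wg ig]] [g' [gt' wg' lg']].
have vw : v != w by rewrite eq_sym.
have vne u : deg u = 3%N -> v != u by move=> du; apply/eqP => E; rewrite E in dv.
have tri f f' h u : f \in tedges -> f' \in tedges -> v \in f -> v \in f' -> f != f' ->
    w \in f -> h \in tedges -> w \in h -> deg u = 3%N -> u \in f' -> u \in h -> False.
  move=> ft ft' vf vf' nff' wf ht wh du uf' uh.
  have [evw _] := tedge2 ft vf wf vw; have [evu _] := tedge2 ft' vf' uf' (vne u du).
  case: (eqVneq u w) => [uw|nuw].
    by case/eqP: nff'; apply: (tedge_eq ft ft' vf wf vf' _ vw); rewrite -uw.
  have [euw _] := tedge2 ht uh wh nuw.
  by apply: (@Htri v u w); split; rewrite // Hsym.
have [E1|[u [du u1 ug]]] := share_index t1 gt i1 ig;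
have [E2|[u' [du' u2 ug']]] := share_index t2 gt' l2 lg'.
- by case/eqP: n12; apply: (tedge_eq t1 t2 v1 _ v2 _ vw); rewrite ?E1 ?E2.
- by apply: (tri f1 f2 g' u') => //; rewrite E1.
- by apply: (tri f2 f1 g u) => //; rewrite 1?eq_sym // E2.
- have [vu _] := tedge2 t1 v1 u1 (vne u du); have [vu' _] := tedge2 t2 v2 u2 (vne u' du').
  have uu' := deg3_common vu vu' du du'.
  by case/eqP: n12; apply: (tedge_eq t1 t2 v1 u1 v2 _ (vne u du)); rewrite uu'.
Qed.

Lemma star_nbr_deg u j l h1 h2 h3 h w : star u j l h1 h2 h3 -> h \in edges_at u ->
  w \in h -> w != u -> deg w <> 3%N.
Proof.
move=> st /edges_atP[ht uh] wh wu; rewrite eq_sym in wu.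
have [uw _] := tedge2 ht uh wh wu; exact: deg3_adj uw (star_deg st).
Qed.

(** [j] occurs only on edges at [u]: any other edge carrying it would meet [h1] in a second degree-3
    vertex, adjacent to [u]. *)
Lemma star_appears1 u j l h1 h2 h3 w : star u j l h1 h2 h3 -> w != u ->
  appears e lab w j -> w \in h1 \/ w \in h3.
Proof.
move=> st wu [g [gt wg jg]]; have /edges_atP[t1 u1] := star1 st.
have gu : u \in g.
  have j1 : j \in idx h1 by rewrite (star_lab1 st) inE.
  have [<-//|[u' [du' u'1 u'g]]] := share_index t1 gt j1 jg.
  case: (eqVneq u' u) => [<-//|nu'].
  by case: (star_nbr_deg st (star1 st) u'1 nu').
have [] := star_edge st (_ : g \in edges_at u); first by apply/edges_atP.
- by move=> <-; left.
- by move=> gE; move: jg; rewrite gE (star_lab2 st) inE (negPf (star_neq st)).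
- by move=> <-; right.
Qed.

Lemma star_appears2 u j l h1 h2 h3 w : star u j l h1 h2 h3 -> w != u ->
  appears e lab w l -> w \in h2 \/ w \in h3.
Proof.
move=> st wu [g [gt wg jg]]; have /edges_atP[t1 u1] := star2 st.
have gu : u \in g.
  have j1 : l \in idx h2 by rewrite (star_lab2 st) inE.
  have [<-//|[u' [du' u'1 u'g]]] := share_index t1 gt j1 jg.
  case: (eqVneq u' u) => [<-//|nu'].
  by case: (star_nbr_deg st (star2 st) u'1 nu').
have [] := star_edge st (_ : g \in edges_at u); first by apply/edges_atP.
- by move=> gE; move: jg; rewrite gE (star_lab1 st) inE eq_sym (negPf (star_neq st)).
- by move=> <-; left.
- by move=> <-; right.
Qed.

Lemma star_edges_meet u j l h1 h2 h3 h h' w : star u j l h1 h2 h3 -> w != u ->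
  h \in edges_at u -> h' \in edges_at u -> w \in h -> w \in h' -> h = h'.
Proof.
move=> st wu /edges_atP[ht uh] /edges_atP[ht' uh'] wh wh'.
exact: (tedge_eq ht ht' wh uh wh' uh' wu).
Qed.

(** [f1] supplies the coordinate [a] of the line and [f2] the coordinate [b]. The label of [f1] has
    a single index, as [#|A| = 1] requires; in [Frame2] that of [f2] may be a difference. *)
Variant frame v (f1 f2 : {set T}) : Prop :=
| Frame3 j l f3 of star v j l f1 f2 f3
| Frame2 i of deg v <> 3%N & f1 \in edges_at v & f2 \in edges_at v & f1 != f2
    & (forall f, f \in edges_at v -> f = f1 \/ f = f2) & lab f1 = LBasis i.

(** Outside degree 3, at most one edge at [v] reaches a degree-3 vertex, by [deg3_common]; the other
    has a basis label and is taken as [f1]. *)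
Lemma frame_exists v : deg v <> 0%N -> exists f1 f2, frame v f1 f2.
Proof.
move=> d0; case: (deg v =P 3%N) => [d3|n3].
  have [j [l [h1 [h2 [h3 st]]]]] := star_exists d3.
  by exists h1, h2; apply: Frame3 st.
have [f1 [f2 [in1 in2 n12 all12]]] := edges_at_deg2 n3 d0.
have [/edges_atP[t1 v1] /edges_atP[t2 v2]] := (in1, in2).
have isB f : f \in tedges -> ~~ [exists u in f, deg u == 3%N] -> exists i, lab f = LBasis i.
  move=> ft /existsPn no3; have [_ [h _]] := Hlab; apply: h => // u uf.
  by have := no3 u; rewrite uf /= => /eqP.
case: (boolP [exists u in f1, deg u == 3%N]) => [/existsP[u /andP[u1 /eqP du]]|no1]; last first.
  by have [i li] := isB f1 t1 no1; exists f1, f2; apply: Frame2 li.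
case: (boolP [exists u in f2, deg u == 3%N]) => [/existsP[u' /andP[u2 /eqP du']]|no2]; last first.
  have [i li] := isB f2 t2 no2; exists f2, f1; apply: Frame2 li => //.
    by rewrite eq_sym.
  by move=> f /all12[]; [right|left].
have vne x : deg x = 3%N -> v != x by move=> dx; apply/eqP => E; rewrite E in n3.
have [vu _] := tedge2 t1 v1 u1 (vne u du); have [vu' _] := tedge2 t2 v2 u2 (vne u' du').
have uu' := deg3_common vu vu' du du'.
by case/eqP: n12; apply: (tedge_eq t1 t2 v1 u1 v2 _ (vne u du)); rewrite uu'.
Qed.

(** * The lines, their marked points and the quadrics *)

Section Lines.
Variables (k : fieldType) (F1 F2 : T -> {set T}).
Hypothesis HF : forall v, frame v (F1 v) (F2 v).

Definition lineA v : {set 'I_N} := [set i in idx (F1 v)].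
Definition lineB v : {set 'I_N} := [set i in idx (F2 v)].
Definition lmap v : {mpoly k[N]} -> {mpoly k[2]} := line_map (lineA v) (lineB v).
HB.instance Definition _ v := GRing.RMorphism.copy (lmap v) (line_map (lineA v) (lineB v)).

Lemma F1_edge v : F1 v \in edges_at v.
Proof. by case: (HF v) => [j l f3 /star1|]. Qed.
Lemma F2_edge v : F2 v \in edges_at v.
Proof. by case: (HF v) => [j l f3 /star2|]. Qed.

Lemma card_lineA v : #|lineA v| = 1%N.
Proof.
have [i li] : exists i, lab (F1 v) = LBasis i.
  by case: (HF v) => [j l f3 /star_lab1|i _ _ _ _ _]; [exists j|exists i].
by rewrite -(cards1 i); apply: eq_card => x; rewrite !inE li inE.
Qed.

Lemma lineB_neq0 v : lineB v != set0.
Proof. by apply/set0Pn; have [i ii] := label_nonempty (F2 v); exists i; rewrite inE. Qed.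

Lemma idx_F12 v i : i \in idx (F1 v) -> i \in idx (F2 v) -> False.
Proof.
case: (HF v) => [j l f3 st|i' dv e1 e2 n12 _ _].
  rewrite (star_lab1 st) (star_lab2 st) !inE => /eqP-> /eqP E.
  by have := star_neq st; rewrite E eqxx.
by move=> h1 h2; case/eqP: n12; apply: (disjoint_index dv e1 e2 h1 h2).
Qed.

Lemma lineAB_disjoint v : [disjoint lineA v & lineB v].
Proof.
rewrite -setI_eq0; apply/eqP/setP => i; rewrite !inE.
by apply/negP => /andP[h1 h2]; apply: idx_F12 h1 h2.
Qed.

Lemma lmapX v i : lmap v 'X_i =
  if i \in idx (F1 v) then va else if i \in idx (F2 v) then vb else 0.
Proof. by rewrite /lmap line_mapX !inE. Qed.

Lemma lmapX_out v i : ~ appears e lab v i -> lmap v 'X_i = 0.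
Proof.
move=> na; rewrite lmapX; case: ifP => h1.
  by case: na; apply/appearsP; exists (F1 v); rewrite ?F1_edge.
by case: ifP => // h2; case: na; apply/appearsP; exists (F2 v); rewrite ?F2_edge.
Qed.

Lemma lmapX_edge v f i i' : deg v <> 3%N -> f \in edges_at v -> i \in idx f ->
  i' \in idx f -> lmap v 'X_i = lmap v 'X_i'.
Proof.
case: (HF v) => [j l f3 /star_deg//|_ dv _ _ _ all12 _] _ /all12[] -> hi hi'.
  by rewrite !lmapX hi hi'.
rewrite !lmapX hi hi' !ifF //; apply/negP => h; [exact: idx_F12 h hi'|exact: idx_F12 h hi].
Qed.

(** Restriction to the point attached to the edge [f]. It depends on [f] alone, so the lines of both
    ends of [f] pass through that point. *)
Definition point_map f (c : {mpoly k[2]}) : {mpoly k[N]} -> {mpoly k[2]} :=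
  comp_mpoly [tuple if i \in idx f then c else 0 | i < N].

Lemma sub2_lmap v f x y c h :
  (forall i, sub2 x y (lmap v 'X_i) = if i \in idx f then c else 0) ->
  sub2 x y (lmap v h) = point_map f c h.
Proof.
move=> hX; rewrite /sub2 /lmap /line_map comp_mpoly_comp; congr (comp_mpoly _ h).
apply: eq_from_tnth => i; rewrite !tnth_mktuple -hX /sub2 /lmap /line_map.
by rewrite comp_mpolyXU -tnth_nth tnth_mktuple.
Qed.

Lemma sub2_lmap1 v c h : sub2 c 0 (lmap v h) = point_map (F1 v) c h.
Proof.
apply: sub2_lmap => i; rewrite lmapX; case: ifP => _; first by rewrite sub2_0.
by case: ifP => _; rewrite ?sub2_1 ?rmorph0.
Qed.

Lemma sub2_lmap2 v c h : sub2 0 c (lmap v h) = point_map (F2 v) c h.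
Proof.
apply: sub2_lmap => i; rewrite lmapX; case: ifP => h1.
  by rewrite sub2_0 ifF //; apply/negP => h2; apply: idx_F12 h1 h2.
by case: ifP => _; rewrite ?sub2_1 ?rmorph0.
Qed.

Lemma sub2_lmap3 v j l f3 c h : star v j l (F1 v) (F2 v) f3 ->
  sub2 c c (lmap v h) = point_map f3 c h.
Proof.
move=> st; apply: sub2_lmap => i; rewrite lmapX (star_lab1 st) (star_lab2 st).
rewrite (star_lab3 st) !inE; case: ifP => _; first by rewrite sub2_0.
by case: ifP => _; rewrite ?sub2_1 ?rmorph0.
Qed.

Lemma lmap0_point v f c h : f \in edges_at v -> lmap v h = 0 -> point_map f c h = 0.
Proof.
move=> fv h0; have [|[|[j [l st]]]] :
    f = F1 v \/ (f = F2 v \/ exists j l, star v j l (F1 v) (F2 v) f).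
  case: (HF v) => [j l f3 st|i _ _ _ _ /(_ f fv)[] fE _];
    [|by left|by right; left].
  have [->|->|->] := star_edge st fv; [by left|by right; left|right; right].
  by exists j, l.
- by move=> ->; rewrite -sub2_lmap1 h0 rmorph0.
- by move=> ->; rewrite -sub2_lmap2 h0 rmorph0.
- by rewrite -(sub2_lmap3 c h st) h0 rmorph0.
Qed.

Definition idealU (U : {set T}) (h : {mpoly k[N]}) : Prop :=
  forall w, w \in U -> lmap w h = 0.

Lemma idealU_ideal U : is_ideal (idealU U).
Proof.
split=> [w _|f g hf hg w wU|f g hf w wU].
- by rewrite rmorph0.
- by rewrite rmorphD /= hf ?hg // addr0.
- by rewrite rmorphM /= hf // mul0r.
Qed.

Section Star.
Variables (u : T) (j l : 'I_N) (h1 h2 h3 : {set T}).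
Hypothesis st : star u j l h1 h2 h3.

Lemma star_lmap_eq w : w != u -> w \in h3 -> lmap w 'X_j = lmap w 'X_l.
Proof.
move=> wu w3; have /edges_atP[t3 u3] := star3 st.
apply: (@lmapX_edge w h3); first exact: star_nbr_deg st (star3 st) w3 wu.
- exact/edges_atP.
- by rewrite (star_lab3 st) !inE eqxx.
- by rewrite (star_lab3 st) !inE eqxx orbT.
Qed.

Lemma star_lmap0_1 w : w != u -> w \notin h1 -> w \notin h3 -> lmap w 'X_j = 0.
Proof.
by move=> wu w1 w3; apply: lmapX_out => /(star_appears1 st wu)[]; apply/negP.
Qed.

Lemma star_lmap0_2 w : w != u -> w \notin h2 -> w \notin h3 -> lmap w 'X_l = 0.
Proof.
by move=> wu w1 w3; apply: lmapX_out => /(star_appears2 st wu)[]; apply/negP.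
Qed.

(** On the lines at the other end of [h3] the two coordinates agree; away from [h1] and [h3] the
    first one is zero. *)
Lemma star_quad1 w : w != u -> w \notin h1 -> lmap w ('X_j * ('X_j - 'X_l)) = 0.
Proof.
move=> wu w1; rewrite rmorphM rmorphB /=.
case: (boolP (w \in h3)) => [w3|nw3]; first by rewrite star_lmap_eq // subrr mulr0.
by rewrite star_lmap0_1 ?mul0r.
Qed.

Lemma star_quad2 w : w != u -> w \notin h2 -> lmap w ('X_l * ('X_j - 'X_l)) = 0.
Proof.
move=> wu w1; rewrite rmorphM rmorphB /=.
case: (boolP (w \in h3)) => [w3|nw3]; first by rewrite star_lmap_eq // subrr mulr0.
by rewrite star_lmap0_2 ?mul0r.
Qed.

Lemma star_quad3 w : w != u -> w \notin h3 -> lmap w ('X_j * 'X_l) = 0.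
Proof.
move=> wu w3; rewrite rmorphM /=; case: (boolP (w \in h1)) => [w1|nw1].
  rewrite (star_lmap0_2 wu) ?mulr0 //; apply/negP => w2.
  by have := star12 st; rewrite (star_edges_meet st wu (star1 st) (star2 st) w1 w2) eqxx.
by rewrite (star_lmap0_1 wu) ?mul0r.
Qed.
End Star.

Lemma mpolyXX_homog (i i' : 'I_N) : 'X_i * 'X_i' \is [in k[N], 2.-homog].
Proof. by apply: (@dhomogM _ _ _ 1%N _ 1%N); rewrite dhomogX /= mdeg1. Qed.

Lemma lifts_quad (U : {set T}) v i i' i'' h :
  (forall w, w \in U :\ v -> lmap w ('X_i * ('X_i' - 'X_i'')) = 0) ->
  lmap v ('X_i * ('X_i' - 'X_i'')) = h ->
  lifts (lineA v) (lineB v) (idealU (U :\ v)) 2 h.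
Proof.
move=> hU hv; exists ('X_i * ('X_i' - 'X_i'')); split=> //.
by rewrite mulrBr; apply: rpredB; apply: mpolyXX_homog.
Qed.

Lemma lifts_quad_mul (U : {set T}) v i i' h :
  (forall w, w \in U :\ v -> lmap w ('X_i * 'X_i') = 0) ->
  lmap v ('X_i * 'X_i') = h ->
  lifts (lineA v) (lineB v) (idealU (U :\ v)) 2 h.
Proof.
by move=> hU hv; exists ('X_i * 'X_i'); split=> //; apply: mpolyXX_homog.
Qed.

(** If [f] has no degree-3 end, [x_i^2] vanishes on all lines off [f]. If it ends at [u] of degree
    3, [x_i] also lives on other edges of [u], and the square is replaced by the quadric of the star
    of [u] that has the same restriction to [L_v]. *)
Lemma lifts_square (U : {set T}) v f i : deg v <> 3%N -> f \in edges_at v ->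
  i \in idx f -> (forall w, w \in U :\ v -> w \notin f) ->
  lifts (lineA v) (lineB v) (idealU (U :\ v)) 2 (lmap v 'X_i * lmap v 'X_i).
Proof.
move=> dv fv fi Uf; have /edges_atP[ft vf] := fv.
case: (boolP [exists u in f, deg u == 3%N]) => [/existsP[u /andP[uf /eqP du]]|/existsPn no3].
  have vu : v != u by apply/eqP => E; rewrite E in dv.
  have Uu w : w \in U :\ v -> w != u.
    by move=> /Uf; apply: contraNneq => ->.
  have [j [l [h1 [h2 [h3 st]]]]] := star_exists du.
  have fu : f \in edges_at u by apply/edges_atP.
  have meet h : h \in edges_at u -> f != h -> v \notin h.
    move=> hu; apply: contra => vh; apply/eqP.
    exact: star_edges_meet st vu fu hu vf vh.
  have [fE|fE|fE] := star_edge st fu.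
  - move: fi; rewrite fE (star_lab1 st) inE => /eqP ->.
    apply: (@lifts_quad U v j j l) => [w wU|].
      by apply: (star_quad1 st (Uu w wU)); rewrite -fE; apply: Uf.
    rewrite rmorphM rmorphB /= (star_lmap0_2 st vu) ?subr0 //; apply: meet; rewrite ?fE.
    + exact: star2 st.
    + exact: star12 st.
    + exact: star3 st.
    + exact: star13 st.
  - move: fi; rewrite fE (star_lab2 st) inE => /eqP ->.
    apply: (@lifts_quad U v l l j) => [w wU|].
      rewrite -opprB mulrN rmorphN /=; apply/eqP; rewrite oppr_eq0; apply/eqP.
      by apply: (star_quad2 st (Uu w wU)); rewrite -fE; apply: Uf.
    rewrite rmorphM rmorphB /= (star_lmap0_1 st vu) ?subr0 //; apply: meet; rewrite ?fE.
    + exact: star1 st.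
    + by rewrite eq_sym; exact: star12 st.
    + exact: star3 st.
    + exact: star23 st.
  - have v3 : v \in h3 by rewrite -fE.
    have -> : lmap v 'X_i * lmap v 'X_i = lmap v ('X_j * 'X_l).
      rewrite rmorphM /= (star_lmap_eq st vu v3); move: fi.
      by rewrite fE (star_lab3 st) !inE => /orP[] /eqP->; rewrite ?(star_lmap_eq st vu v3).
    apply: lifts_quad_mul erefl => w wU.
    by apply: (star_quad3 st (Uu w wU)); rewrite -fE; apply: Uf.
apply: (@lifts_quad_mul U v i i) => [w wU|]; last by rewrite rmorphM.
rewrite rmorphM /= lmapX_out ?mul0r // => -[g [gt wg gi]].
have [fg|[u [du uf _]]] := share_index ft gt fi gi.
  by have := Uf w wU; rewrite fg wg.
by have := no3 u; rewrite uf du.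
Qed.

Lemma vertex_step (U : {set T}) v n : v \in U ->
  (deg v = 3%N -> exists2 w, e v w & w \notin U) ->
  koszul_vanish (idealU (U :\ v)) (3 - n.+1%:Z) n.+1 ->
  koszul_vanish (idealU U) (3 - n.+1%:Z) n.+1.
Proof.
move=> vU hv3.
have I'E h : idealU U h <-> idealU (U :\ v) h /\ line_map (lineA v) (lineB v) h = 0.
  split=> [hU|[hU hv] w wU]; first by split=> [w /setD1P[_ /hU]|]; last exact: hU.
  by case: (eqVneq w v) => [->//|wv]; apply: hU; rewrite !inE wv.
(* Tells whether the point of [f] already lies on a line of [U :\ v]. *)
pose b f := [exists w in U :\ v, w \in f].
have bP f : ~~ b f -> forall w, w \in U :\ v -> w \notin f.
  by move=> /existsPn nb w wU; have := nb w; rewrite wU.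
have bpt f c h : f \in edges_at v -> idealU (U :\ v) h -> b f -> point_map f c h = 0.
  move=> /edges_atP[ft _] hU /existsP[w /andP[wU wf]].
  by apply: (@lmap0_point w); [apply/edges_atP|apply: hU].
have step := line_step (idealU_ideal (U :\ v)) (lineAB_disjoint v) (card_lineA v)
  (lineB_neq0 v) I'E.
have s1 h : idealU (U :\ v) h -> b (F1 v) -> sub2 va 0 (lmap v h) = 0.
  by rewrite sub2_lmap1; apply: bpt; apply: F1_edge.
have s2 h : idealU (U :\ v) h -> b (F2 v) -> sub2 0 vb (lmap v h) = 0.
  by rewrite sub2_lmap2; apply: bpt; apply: F2_edge.
case: (HF v) => [j l f3 st|i dv e1 e2 n12 all12 li].
  (* The edge from [v] to a vertex outside [U] imposes no point. *)
  have nb : ~~ [&& b (F1 v), b (F2 v) & b f3].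
    have [w vw wU] := hv3 (star_deg st).
    have nbf f : f = [set v; w] -> ~~ b f.
      move=> ->; apply/existsPn => x; apply/negP => /andP[/setD1P[xv xU]].
      by case/set2P => xE; rewrite xE ?eqxx // in xv xU; rewrite xU in wU.
    have vwE : [set v; w] \in edges_at v by apply/edges_atP; rewrite tedge_pair // set21.
    by have [/esym/nbf/negPf->|/esym/nbf/negPf->|/esym/nbf/negPf->] := star_edge st vwE;
      rewrite ?andbF.
  have [vj vl] : lmap v 'X_j = va /\ lmap v 'X_l = vb.
    by rewrite !lmapX (star_lab1 st) (star_lab2 st) !inE !eqxx eq_sym (negPf (star_neq st)).
  have Uv w : w \in U :\ v -> w != v by case/setD1P.
  apply: (step (b (F1 v)) (b (F2 v)) (b f3)) => //.
    by move=> h hU; rewrite (sub2_lmap3 va h st); apply: bpt => //; apply: star3 st.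
  apply: lifts_quad3 => //.
  - exact: idealU_ideal.
  - move/bP => nw; apply: (@lifts_quad U v j j l) => [w wU|].
      by apply: (star_quad1 st (Uv w wU)); apply: nw.
    by rewrite rmorphM rmorphB /= vj vl.
  - move/bP => nw; apply: (@lifts_quad U v l j l) => [w wU|].
      by apply: (star_quad2 st (Uv w wU)); apply: nw.
    by rewrite rmorphM rmorphB /= vj vl.
  - move/bP => nw; apply: (@lifts_quad_mul U v j l) => [w wU|].
      by apply: (star_quad3 st (Uv w wU)); apply: nw.
    by rewrite rmorphM /= vj vl.
have [l l2] := label_nonempty (F2 v).
have i1 : i \in idx (F1 v) by rewrite li inE.
have [vi vl] : lmap v 'X_i = va /\ lmap v 'X_l = vb.
  by rewrite !lmapX i1 l2 ifF //; apply/negP => h; apply: idx_F12 h l2.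
apply: (step (b (F1 v)) (b (F2 v)) false) => //; first by rewrite !andbF.
apply: lifts_quad2.
- apply: (@lifts_quad_mul U v i l) => [w /setD1P[wv _]|]; last by rewrite rmorphM /= vi vl.
  rewrite rmorphM /=; have [z|nz] := eqVneq (lmap w 'X_i) 0; first by rewrite z mul0r.
  have [z|nz'] := eqVneq (lmap w 'X_l) 0; first by rewrite z mulr0.
  have app x : lmap w 'X_x != 0 -> appears e lab w x.
    rewrite lmapX => ne; apply/appearsP; move: ne.
    case: ifP => h; first by exists (F1 w) => //; apply: F1_edge.
    case: ifP => h'; first by exists (F2 w) => //; apply: F2_edge.
    by rewrite eqxx.
  by case: (not_both_appear dv wv e1 e2 n12 i1 l2 (app _ nz) (app _ nz')).
- by move/bP => nw; rewrite -vi; apply: lifts_square dv e1 i1 nw.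
- by move/bP => nw; rewrite -vl; apply: lifts_square dv e2 l2 nw.
Qed.

Hypotheses (Hconn : connectedG e) (Hdeglt : exists v : T, (deg v < 3)%N).

(** If no edge leaves [U], connectedness makes [U] the whole graph, which contains a vertex of
    degree below 3; for it the condition is vacuous. *)
Lemma boundary_vertex (U : {set T}) : U != set0 ->
  exists2 v, v \in U & deg v = 3%N -> exists2 w, e v w & w \notin U.
Proof.
move=> /set0Pn[v0 v0U].
case: (boolP [exists v in U, [exists w, e v w && (w \notin U)]]).
  move=> /existsP[v /andP[vU /existsP[w /andP[vw wU]]]].
  by exists v => // _; exists w.
move=> /existsPn nb; have [v dv] := Hdeglt.
exists v; last by move=> d3; rewrite d3 in dv.
have clU : fingraph.closed e U.
  apply: intro_closed; first exact: sym_connect_sym.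
  move=> x y xy xU; apply: contraT => yU; have := nb x.
  by rewrite xU /= => /existsPn/(_ y); rewrite xy yU.
by rewrite -(closed_connect clU (Hconn v0 v)).
Qed.

Lemma koszul_vanish_idealU (U : {set T}) n : koszul_vanish (idealU U) (3 - n.+1%:Z) n.+1.
Proof.
have [c] := ubnP #|U|; elim: c U => // c IH U; rewrite ltnS => leU.
case: (eqVneq U set0) => [->|U0].
  by apply: koszul_vanish_base => // f i w; rewrite inE.
have [v vU hv] := boundary_vertex U0.
apply: (vertex_step vU hv); apply: IH.
by rewrite (cardsD1 v) vU in leU.
Qed.
End Lines.

(** * The ideal of [C_G] as the common kernel of the restrictions *)

Section VanishingIdeal.
Variables (k : closedFieldType) (F1 F2 : T -> {set T}).
Hypothesis HF : forall v, frame v (F1 v) (F2 v).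

Lemma meval_lmap v (h : {mpoly k[N]}) x y : (lmap (k := k) F1 F2 v h).@[pair2 x y] =
  h.@[fun i => (lmap (k := k) F1 F2 v 'X_i).@[pair2 x y]].
Proof.
rewrite {1}/lmap /line_map comp_mpoly_meval; apply: meval_eq => i.
by rewrite /lmap /line_map comp_mpolyXU -tnth_nth.
Qed.

Lemma Lv_line v x y : Lv e lab v (fun i => (lmap (k := k) F1 F2 v 'X_i).@[pair2 x y]).
Proof.
move=> p [[i [na ->]]|[dv [f [j [l [ft vf lf ->]]]]]]; rewrite -meval_lmap.
  by rewrite (lmapX_out k HF na) meval0.
rewrite rmorphB /= (@lmapX_edge k F1 F2 HF v f j l) ?subrr ?meval0 //.
- exact/edges_atP.
- by rewrite lf !inE eqxx.
- by rewrite lf !inE eqxx orbT.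
Qed.

Lemma Lv_line_inv v (z : 'I_N -> k) : Lv e lab v z ->
  exists x y, z =1 fun i => (lmap (k := k) F1 F2 v 'X_i).@[pair2 x y].
Proof.
move=> zL.
have z_out i : i \notin idx (F1 v) -> i \notin idx (F2 v) -> z i = 0.
  move=> i1 i2; rewrite -(mevalXU z i); apply: zL; left; exists i; split=> //.
  move/appearsP => [f fv fi]; case: (HF v) => [j l f3 st|i' dv _ _ _ /(_ f fv)[] fE _].
  - move: i1 i2; rewrite (star_lab1 st) (star_lab2 st) !inE => i1 i2.
    by have [fE|fE|fE] := star_edge st fv; move: fi;
      rewrite fE ?(star_lab1 st) ?(star_lab2 st) ?(star_lab3 st) !inE ?(negPf i1) ?(negPf i2).
  - by rewrite fE (negPf i1) in fi.
  - by rewrite fE (negPf i2) in fi.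
have z_edge f i i' : f \in edges_at v -> (forall j l, lab f = LDiff j l -> deg v <> 3%N) ->
    i \in idx f -> i' \in idx f -> z i = z i'.
  move=> /edges_atP[ft vf]; case lf : (lab f) => [j|j l] /= nd; rewrite !inE.
    by move=> /eqP-> /eqP->.
  have zz : z j = z l.
    apply/eqP; rewrite -subr_eq0 -(mevalXU z j) -(mevalXU z l) -mevalB; apply/eqP/zL.
    by right; split; [exact: nd erefl|exists f, j, l].
  by move=> /orP[] /eqP-> /orP[] /eqP->.
have nd1 j l : lab (F1 v) = LDiff j l -> deg v <> 3%N.
  by case: (HF v) => [j' l' f3 st|//]; rewrite (star_lab1 st).
have nd2 j l : lab (F2 v) = LDiff j l -> deg v <> 3%N.
  by case: (HF v) => [j' l' f3 st|//]; rewrite (star_lab2 st).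
have [i1 i1P] := label_nonempty (F1 v); have [i2 i2P] := label_nonempty (F2 v).
(* The parameters are read off at any index of each frame edge; when an edge has two indices, the
   generator [x_j - x_l] makes the choice irrelevant. *)
exists (z i1), (z i2) => i; rewrite lmapX; case: ifP => h1.
  by rewrite mevalXU (z_edge _ _ _ (F1_edge HF v) nd1 h1 i1P).
case: ifP => h2; first by rewrite mevalXU (z_edge _ _ _ (F2_edge HF v) nd2 h2 i2P).
by rewrite meval0 z_out ?h1 ?h2.
Qed.

Lemma ideal_CG_idealU (h : {mpoly k[N]}) :
  idealU F1 F2 [set: T] h <-> ideal_CG e lab h.
Proof.
split=> [hU v z /Lv_line_inv[x [y zE]]|hC v _].
  by rewrite (meval_eq _ zE) -meval_lmap hU ?inE // meval0.
by apply: mpoly2_eq0_meval => x y; rewrite meval_lmap; apply: (hC v _ (@Lv_line v x y)).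
Qed.
End VanishingIdeal.
End Labeling.
End Graph.

Lemma koszul_vanish_ext (k : fieldType) N (I I' : {mpoly k[N]} -> Prop) m p :
  (forall f, I f <-> I' f) -> koszul_vanish I m p -> koszul_vanish I' m p.
Proof.
move=> II' vanI E D g DE gP g0; have [s cs|r [b [bP db]]] := vanI E D g DE _ g0.
  by have [f [d [/II' If fd dE gE]]] := gP s cs; exists f, d.
exists r, b; split=> // s cs.
by have [f [d [/II' If fd dE gE]]] := bP s cs; exists f, d.
Qed.

Lemma ideal_CG_ideal (T : finType) (e : rel T) (k : fieldType) N (lab : {set T} -> label N) :
  is_ideal (ideal_CG (R := k) e lab).
Proof.
split=> [v x _|f g hf hg v x vx|f g hf v x vx]; first by rewrite meval0.
  by rewrite mevalD (hf v x vx) (hg v x vx) addr0.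
by rewrite mevalM (hf v x vx) mul0r.
Qed.

Theorem theorem2p1 (k : closedFieldType) (Hchar : [pchar k] =i pred0)
    (T : finType) (e : rel T)
    (Hsym : ssrbool.symmetric e) (Hirr : irreflexive e)
    (Hconn : connectedG e)
    (Hdeg : forall v : T, (deg e v <= 3)%N)
    (Hdeglt : exists v : T, (deg e v < 3)%N)
    (Hfar : deg3_far e)
    (Htri : triangle_free e)
    (lab : {set T} -> label (gn e).+1)
    (Hlab : admissible e lab) :
  sheaf_regular (@ideal_CG T e k (gn e).+1 lab) 3.
Proof.
case=> // n _; apply: cech_vanish_of_koszul => //; first exact: ideal_CG_ideal.
(* A vertex of degree 0 has no frame. By connectedness it is then the only vertex, no index appears
   at it, and its cone is the origin: the projective union is empty. *)
case: (boolP [exists v, deg e v == 0%N]) => [/existsP[v0 /eqP d0]|/existsPn no0].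
  apply: koszul_vanish_base => // f i v x xL; rewrite mevalM mevalXU.
  suff -> : x i = 0 by rewrite mulr0.
  rewrite -(mevalXU x i); apply: xL; left; exists i; split=> // -[g [gt vg _]].
  have v0w w : e v0 w = false by have /setP/(_ w) := cards0_eq d0; rewrite !inE.
  have vE : v = v0.
    have /connectP[[|w p]] := Hconn v0 v; first by move=> _ ->.
    by rewrite /= v0w.
  have [[w]|[]] := tedge_inv Hsym gt vg; first by rewrite vE v0w.
  by rewrite vE d0.
have /fin_all_exists[F FP] v : exists F : {set T} * {set T}, frame e lab v F.1 F.2.
  have [|f1 [f2 fr]] := frame_exists Hsym Hirr Hdeg Hfar Hlab (v := v); last by exists (f1, f2).
  by apply/eqP; apply: no0.
apply: (koszul_vanish_ext (ideal_CG_idealU Hsym Hlab (k := k) FP)).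
exact: (koszul_vanish_idealU Hsym Hirr Hfar Htri Hlab FP Hconn Hdeglt).
Qed.
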